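(* For $k,m\in\mathbb{N}$ (positive integers), let $a=\lceil 2\sqrt m\rceil$ and let $\theta>0$ satisfy $\left(\frac{2\theta}{\sqrt{2\pi k}}\right)^m\binom{ak}{k}=1$. Let $Y_1,\dots,Y_{ak}\in\mathbb{R}^m$ be i.i.d. random vectors with independent coordinates. For $k_0\in\mathbb{N}$, $\gamma\ge0$, $M>0$, assume that for all $i\in[m]$, the coordinate $Y_{1,i}$ is a $(\gamma,k_0)$-Gaussian convergent continuous random variable with maximum density at most $M$. Then, if $$k\ge\max\left\{(4\sqrt m+2)k_0,\ 144\,m^{3/2}(\log M+3),\ 150\,000(\gamma+1)m^{7/4}\right\},$$ for any vector $D\in\mathbb{R}^m$ with $\|D\|_2\le\sqrt k$ the following holds: $$\Pr\left[\exists K\subset[ak]:\ |K|=k,\ \Big\|\Big(\sum_{j\in K}Y_j\Big)-D\Big\|_\infty\le\theta\right]\ge\frac1{25}.$$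
   Context: A real random variable $X$ with a density is $(\gamma,k_0)$-Gaussian convergent ($k_0\in\mathbb{N}$, $\gamma\ge0$) if, for $X_1,X_2,\dots$ i.i.d. copies of $X$, the density $f_n$ of $\sum_{i=1}^n X_i/\sqrt n$ satisfies $|f_n(x)-\varphi(x)|\le\gamma/n$ for all $x\in\mathbb{R}$ and all $n\ge k_0$, where $\varphi(x)=\frac1{\sqrt{2\pi}}e^{-x^2/2}$. A continuous random variable has maximum density at most $M$ if its probability density $f$ satisfies $\sup_x f(x)\le M$. $[l]:=\{1,\dots,l\}$; $\log$ is the natural logarithm. *)

(* Defs.v *)
From HB Require Import structures.
From mathcomp Require Import all_boot all_order all_algebra.
From mathcomp Require Import all_classical all_reals all_analysis.
From mathcomp Require Import measurable_realfun.

Set Implicit Arguments.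
Unset Strict Implicit.
Unset Printing Implicit Defensive.

Import Order.TTheory GRing.Theory Num.Theory.
Import numFieldNormedType.Exports.

Local Open Scope classical_set_scope.
Local Open Scope ring_scope.

Section independence.
Context {d d' : measure_display} {T : measurableType d} {T' : measurableType d'}.
Context {R : realType} {P : probability T R}.

Definition mutually_independent {I : finType} (X : I -> {RV P >-> T'}) : Prop :=
  forall (J : {set I}) (A : I -> set T'), (forall i, measurable (A i)) ->
    P (\bigcap_(i in [set` J]) (X i @^-1` A i)) =
    (\prod_(i in J) P (X i @^-1` A i))%E.

End independence.

(* The two variables may live on different probability spaces. *)
Definition same_law {d1 d2 d' : measure_display} {T1 : measurableType d1}
    {T2 : measurableType d2} {T' : measurableType d'} {R : realType}
    {P1 : probability T1 R} {P2 : probability T2 R}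
    (X1 : {RV P1 >-> T'}) (X2 : {RV P2 >-> T'}) : Prop :=
  forall A, measurable A -> distribution P1 X1 A = distribution P2 X2 A.

Section density.
Context {d : measure_display} {T : measurableType d} {R : realType}.
Context {P : probability T R}.

Definition has_density (X : {RV P >-> R}) (f : R -> R) : Prop :=
  [/\ measurable_fun setT f, (forall x, 0 <= f x) &
      forall A, measurable A ->
        distribution P X A = (\int[lebesgue_measure]_(x in A) (f x)%:E)%E].

(* A density is determined only up to null sets: the bound is asked of some
   version of it. *)
Definition max_density_le (X : {RV P >-> R}) (M : R) : Prop :=
  exists2 f, has_density X f & forall x, f x <= M.

End density.

Section normalized_sum.
Context {d : measure_display} {T : measurableType d} {R : realType}.
Context {P : probability T R}.
Variables (n : nat) (X : 'I_n -> {RV P >-> R}).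

Definition normalized_sum (t : T) : R :=
  \sum_(i < n) X i t / Num.sqrt n%:R.

Let measurable_normalized_sum : measurable_fun setT normalized_sum.
Proof.
by apply: measurable_sum => i; exact: measurable_funM.
Qed.

HB.instance Definition _ :=
  isMeasurableFun.Build _ _ _ _ normalized_sum measurable_normalized_sum.

End normalized_sum.

(* The law of the normalized sum involves only X_1, ..., X_n, so the i.i.d.
   copies are given as a finite family for each n.  They live on an arbitrary
   probability space, since that of X need not carry any independent copy. *)
Definition gaussian_convergent {d : measure_display} {T : measurableType d}
    {R : realType} {P : probability T R} (X : {RV P >-> R})
    (gamma : R) (k0 : nat) : Prop :=
  (exists f, has_density X f) /\
  forall (d' : measure_display) (T' : measurableType d')
    (P' : probability T' R) (n : nat) (X_ : 'I_n -> {RV P' >-> R}),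
  (k0 <= n)%N ->
  mutually_independent X_ -> (forall i, same_law (X_ i) X) ->
  exists2 f, has_density (normalized_sum X_ : {RV P' >-> R}) f &
    forall x, `|f x - normal_pdf 0 1 x| <= gamma / n%:R.

Section random_vector.
Context {d : measure_display} {T : measurableType d} {R : realType}.
Context {P : probability T R}.
Variables (m : nat) (Y : {RV P >-> m.-tuple R}) (i : 'I_m).

Definition coordinate (t : T) : R := tnth (Y t) i.

Let measurable_coordinate : measurable_fun setT coordinate.
Proof.
by apply: (measurableT_comp (measurable_tnth i)).
Qed.

HB.instance Definition _ :=
  isMeasurableFun.Build _ _ _ _ coordinate measurable_coordinate.

End random_vector.

(* Random vectors take values in m.-tuple R, which carries the product sigma
   algebra, while 'rV[R]_m carries the sup norm `|_|. *)
Definition row_of_tuple {R : realType} {m : nat} (y : m.-tuple R) : 'rV[R]_m :=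
  \row_i tnth y i.

Definition l2norm {R : realType} {m : nat} (v : 'rV[R]_m) : R :=
  Num.sqrt (\sum_(i < m) v ord0 i ^+ 2).

(* Main.v *)
(** Second moment method.  Let [Z] be the number of [k]-subsets [K] whose sum is
    [theta]-close to [D].  Gaussian convergence and the choice of [theta] give
    [E Z >= 49/100].  For a pair [K], [K'] with [s = #|K :&: K'|] of the order of
    its mean [k / a], condition on the sum over [K :&: K'] in each coordinate: the
    two remaining sums are independent and nearly Gaussian, and a Gaussian integral
    bounds the joint probability, up to small errors, by
    [(1 - (s / k)^2)^(-m / 2) / 'C(a k, k)^2], hence by [4 / 'C(a k, k)^2]; here
    [a >= 2 sqrt m] is what makes [(s / k)^2 = O(1 / m)].  For the other pairs the
    density bound [M], applied to one vector of [K' :\: K], gives the probability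
    of [K] times [(2 theta M)^m], and these pairs are exponentially rare by a
    Chernoff bound for the hypergeometric law.  Hence [E Z^2 <= 2 E Z + 4], and
    [P(Z > 0) >= (E Z)^2 / (2 E Z + 4) >= 1 / 25]. *)
Require Import Defs.
From HB Require Import structures.
From mathcomp Require Import all_boot all_order all_algebra.
From mathcomp Require Import all_classical all_reals all_analysis.
From mathcomp Require Import measurable_realfun zify ring lra.
Import Order.TTheory GRing.Theory Num.Theory.
Import numFieldNormedType.Exports.

Set Implicit Arguments.
Unset Strict Implicit.
Unset Printing Implicit Defensive.

Local Open Scope classical_set_scope.
Local Open Scope ring_scope.

(** * Independence of blocks *)

(** Put [r = 2 theta / sqrt (2 pi k)], the Gaussian estimate for one coordinate window centred at 0.
    The choice of [theta] reads [r^m 'C(a k, k) = 1]: the heuristic mean of [Z] is 1 at [D = 0], and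
    a centre of Euclidean norm at most [sqrt k] costs only a factor [exp (-1/2)] over all
    coordinates together. Gaussian convergence gives additive errors, while the probabilities are
    products of [m] factors, so each factor must be right up to a relative error [O(1 / m)]. The
    worst error comes from conditioning on [K :&: K']: with [s] of order [k / sqrt m] the density
    error [gamma / s] is of order [gamma sqrt m / k], and it is amplified by [sqrt (k / s)], of
    order [m^(1/4)]. Asking that this be [O(1 / m)] yields the exponent [7/4]. The exponent [3/2]
    comes from the rare pairs: the Chernoff exponent, of order [k / sqrt m], must beat [m log M]. It
    must also absorb the [k^(m/2)] hidden in ['C(a k, k) (2 theta M)^m], which the bound with [7/4]
    already ensures. The bound with [k0] makes all normalized sums in use long enough for Gaussian
    convergence. *)

Section independence_of_blocks.
Context {d : measure_display} {T : measurableType d} {R : realType}.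
Variable P : probability T R.
Local Open Scope ereal_scope.

(** The restriction of [P] to [E] and the multiple of [P] by [P E] are finite measures that agree on
    a pi-system containing [setT], hence on what it generates. *)
Lemma indep_pi_lambda (G : set (set T)) (E : set T) :
  G `<=` measurable -> setI_closed G -> G setT -> measurable E ->
  (forall A, G A -> P (A `&` E) = P A * P E) ->
  forall A, <<s G >> A -> P (A `&` E) = P A * P E.
Proof.
move=> Gm GI GT mE GE A sA.
have PE : P E \is a fin_num by rewrite fin_num_measure.
have PE0 : (0 <= fine (P E))%R by rewrite fine_ge0.
pose m1 := mrestr P mE.
pose m2 := mscale (NngNum PE0) P.
have -> : P (A `&` E) = m1 A by [].
have m2E B : m2 B = P B * P E.
  by rewrite /m2 /= /mscale /= fineK// muleC.
rewrite -m2E.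
apply: (g_sigma_algebra_measure_unique G Gm (fun=> setT)) => //.
- by rewrite bigcup_const.
- by move=> B GB; have := m2E B; rewrite -GE.
- move=> _; rewrite -[X in X < _]/(P (setT `&` E)) setTI.
  by rewrite -ge0_fin_numE.
Qed.

(** The classes are enlarged to their sigma-algebras one index at a time: in [step], [s] lists the
    indices already enlarged, and each new one is an application of [indep_pi_lambda] with the other
    events fixed. *)
Lemma indep_classes_generated (J : finType) (G : J -> set (set T)) :
  (forall j, G j `<=` measurable) -> (forall j, setI_closed (G j)) ->
  (forall j, G j setT) ->
  (forall A : J -> set T, (forall j, G j (A j)) ->
     P (\big[setI/setT]_j A j) = \prod_j P (A j)) ->
  forall A : J -> set T, (forall j, <<s G j >> (A j)) ->
    P (\big[setI/setT]_j A j) = \prod_j P (A j).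
Proof.
move=> Gm GI GT Gindep.
have sm j A : <<s G j >> A -> measurable A.
  by apply: smallest_sub => //; exact: sigma_algebra_measurable.
have step (s : seq J) (A : J -> set T) :
    (forall j, j \in s -> <<s G j >> (A j)) ->
    (forall j, j \notin s -> G j (A j)) ->
    P (\big[setI/setT]_j A j) = \prod_j P (A j).
  elim: s A => [|x s IH] A As Ans; first by apply: Gindep => j; exact: Ans.
  have [xs|xs] := boolP (x \in s).
    apply: IH => j js; first by apply: As; rewrite inE js orbT.
    apply: Ans; rewrite inE negb_or js andbT.
    by apply: contraNneq js => ->.
  have mA j : measurable (A j).
    by have [js|js] := boolP (j \in x :: s); [exact: sm (As _ js)|exact: Gm (Ans _ js)].
  pose E := \big[setI/setT]_(j | j != x) A j.
  have upd C : G x C -> P (C `&` E) = P C * \prod_(j | j != x) P (A j).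
    move=> GC; pose A' j := if j == x then C else A j.
    have : P (\big[setI/setT]_j A' j) = \prod_j P (A' j).
      apply: IH => j js; rewrite /A'; case: eqVneq => [jx|jx] //.
      - by rewrite -jx js in xs.
      - by apply: As; rewrite inE js orbT.
      - by rewrite jx.
      - by apply: Ans; rewrite inE negb_or jx.
    rewrite (bigD1 x)//= [RHS](bigD1 x)//= /A' eqxx.
    rewrite (eq_bigr A); last by move=> j /negbTE ->.
    by rewrite (eq_bigr (P \o A))//; move=> j /negbTE ->.
  (* The case [C = setT] of [upd] removes the index [x] from the product formula. *)
  have PE : P E = \prod_(j | j != x) P (A j).
    by have := upd _ (GT x); rewrite setTI probability_setT mul1e.
  rewrite (bigD1 x)//= [RHS](bigD1 x)//= -PE.
  apply: (indep_pi_lambda (Gm x) (GI x) (GT x)) => //.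
  - by apply: bigsetI_measurable.
  - by move=> C GC; rewrite upd// PE.
  - by apply: As; rewrite inE eqxx.
move=> A sA; apply: (step (enum J)) => // j; by rewrite mem_enum.
Qed.

Context {d' : measure_display} {T' : measurableType d'} {I : finType}.
Variable X : I -> {RV P >-> T'}.

(** A pi-system on [T] generating the sigma-algebra of the variables indexed by [K]. Working with
    these sub-sigma-algebras of [T] expresses the independence of blocks without product spaces. *)
Definition cylinders (K : {set I}) : set (set T) :=
  [set C | exists2 B : I -> set T', (forall i, measurable (B i)) &
     C = \big[setI/setT]_(i in K) (X i @^-1` B i)].

Lemma preimage_RV_measurable i (B : set T') : measurable B ->
  measurable (X i @^-1` B).
Proof. by move=> mB; rewrite -[X in measurable X]setTI; exact: measurable_funP. Qed.

Lemma cylinders_measurable K : cylinders K `<=` measurable.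
Proof.
move=> _ [B mB ->]; apply: bigsetI_measurable => i _.
exact: preimage_RV_measurable.
Qed.

Lemma cylinders_setI_closed K : setI_closed (cylinders K).
Proof.
move=> _ _ [B mB ->] [C mC ->]; exists (fun i => B i `&` C i).
  by move=> i; exact: measurableI.
by rewrite -big_split.
Qed.

Lemma cylinders_setT K : cylinders K setT.
Proof.
exists (fun=> setT) => //.
by rewrite big1// => i _; rewrite preimage_setT.
Qed.

Lemma cylinders_sigma_measurable (K : {set I}) (A : set T) :
  <<s cylinders K >> A -> measurable A.
Proof.
by apply: smallest_sub; [exact: sigma_algebra_measurable|exact: cylinders_measurable].
Qed.

Lemma measurable_fun_cylinders (K : {set I}) i : i \in K ->
  measurable_fun setT (X i : g_sigma_algebraType (cylinders K) -> T').
Proof.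
move=> iK _ B mB; rewrite setTI; apply: sub_sigma_algebra.
exists (fun j => if j == i then B else setT); first by move=> j; case: ifP.
rewrite (bigD1 i)//= eqxx big1 ?setIT// => j /andP[_ /negbTE ->].
by rewrite preimage_setT.
Qed.

Hypothesis indX : mutually_independent X.

Lemma mutually_independent_bigsetI (B : I -> set T') (Q : pred I) :
  (forall i, measurable (B i)) ->
  P (\big[setI/setT]_(i | Q i) (X i @^-1` B i)) = \prod_(i | Q i) P (X i @^-1` B i).
Proof.
move=> mB; have := indX [set i | Q i]%SET mB.
rewrite [X in _ = X -> _](eq_bigl Q); last by move=> i; rewrite inE.
move=> <-; congr (P _); apply/seteqP; split => t.
  move=> tB i /=; rewrite inE => Qi; move: tB.
  by rewrite (bigD1 i)//= => -[].
move=> tB; elim/big_ind : _ => // i Qi.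
by apply: tB; rewrite /= inE.
Qed.

(** Blocks are fibres of [g], hence disjoint by construction: one cylinder per block glues to the
    single family [fun i => B (g i) i], to which mutual independence applies. *)
Lemma indep_blocks (J : finType) (g : I -> J) (A : J -> set T) :
  (forall j, <<s cylinders [set i | g i == j]%SET >> (A j)) ->
  P (\big[setI/setT]_j A j) = \prod_j P (A j).
Proof.
apply: indep_classes_generated => [j|j|j|{}A cA].
- exact: cylinders_measurable.
- exact: cylinders_setI_closed.
- exact: cylinders_setT.
have /choice[B mAB] : forall j, exists B : I -> set T', (forall i, measurable (B i)) /\
    A j = \big[setI/setT]_(i | g i == j) (X i @^-1` B i).
  move=> j; have [B mB ->] := cA j; exists B; split=> //.
  by apply: eq_bigl => i; rewrite inE.
have AE j : A j = \big[setI/setT]_(i | g i == j) (X i @^-1` B (g i) i).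
  by rewrite (mAB j).2; apply: eq_bigr => i /eqP ->.
have mB i : measurable (B (g i) i) by exact: (mAB _).1.
transitivity (\prod_i P (X i @^-1` B (g i) i)).
  rewrite -(mutually_independent_bigsetI predT mB) (partition_big g predT)//=.
  by congr (P _); apply: eq_bigr => j _; rewrite AE.
rewrite (partition_big g predT)//=; apply: eq_bigr => j _.
by rewrite AE mutually_independent_bigsetI.
Qed.

Lemma indep_complementary (K : {set I}) (A B : set T) :
  <<s cylinders K >> A -> <<s cylinders (~: K)%SET >> B ->
  P (A `&` B) = P A * P B.
Proof.
move=> sA sB.
have := @indep_blocks bool (fun i => i \in K) (fun b => if b then A else B).
rewrite !big_bool/=; apply => -[].
  suff -> : [set i | (i \in K) == true]%SET = K by [].
  by apply/setP => i; rewrite inE eqb_id.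
suff -> : [set i | (i \in K) == false]%SET = (~: K)%SET by [].
by apply/setP => i; rewrite !inE eqbF_neg.
Qed.

End independence_of_blocks.

(** Independence identifies the law of [(U, Z)] with the product of the two laws. Fubini is then
    pulled back to [P], where conditioning on [U] means freezing it at an outcome [s]. *)
Lemma indep_fubini d d1 d2 (T : measurableType d) (T1 : measurableType d1)
    (T2 : measurableType d2) (R : realType) (P : probability T R)
    (U : T -> T1) (Z : T -> T2) :
  measurable_fun setT U -> measurable_fun setT Z ->
  (forall A B, measurable A -> measurable B ->
     P (U @^-1` A `&` Z @^-1` B) = (P (U @^-1` A) * P (Z @^-1` B))%E) ->
  forall E, measurable E ->
  P [set t | E (U t, Z t)] = (\int[P]_s P [set t | E (U s, Z t)])%E.
Proof.
move=> mU mZ UZ E mE.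
pose U' : {mfun T >-> T1} := mfun_Sub (mem_set mU).
pose Z' : {mfun T >-> T2} := mfun_Sub (mem_set mZ).
pose W' : {mfun T >-> (T1 * T2)%type} :=
  mfun_Sub (mem_set (measurable_fun_pair mU mZ)).
transitivity ((distribution P U' \x distribution P Z')%E E).
  rewrite (@product_measure_unique _ _ _ _ _ (distribution P U')
    (distribution P Z') (distribution P W')) //.
rewrite /product_measure1 ge0_integral_distribution//.
  apply: eq_integral => s _ /=; rewrite /distribution /pushforward /=.
  by congr (P _); apply/seteqP; split => t /=; rewrite /xsection/= inE.
exact: measurable_fun_xsection.
Qed.

Lemma measurable_section_probability d d1 d2 (T : measurableType d)
    (T1 : measurableType d1) (T2 : measurableType d2) (R : realType)
    (P : probability T R) (U : T -> T1) (Z : T -> T2) (E : set (T1 * T2)) :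
  measurable_fun setT U -> measurable_fun setT Z -> measurable E ->
  measurable_fun setT (fun s => P [set t | E (U s, Z t)]).
Proof.
move=> mU mZ mE.
pose Z' : {mfun T >-> T2} := mfun_Sub (mem_set mZ).
rewrite [X in measurable_fun _ X](_ : _ = (distribution P Z' \o xsection E) \o U).
  by apply: measurableT_comp mU; exact: measurable_fun_xsection.
apply/funext => s; rewrite /= /distribution /pushforward.
by congr (P _); apply/seteqP; split => t /=; rewrite /xsection/= inE.
Qed.

(** * Hypergeometric tails *)

(** Factor by factor, [(l - i) / l <= (N - i) / N], written crosswise. *)
Lemma ffact_cross_leq (l N j : nat) : (l <= N)%N -> (l ^_ j * N ^ j <= N ^_ j * l ^ j)%N.
Proof.
move=> lN; elim: j => [|j IH]; first by rewrite !ffactn0 !expn0.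
rewrite !ffactnSr !expnSr.
have H : ((l - j) * N <= (N - j) * l)%N.
  by rewrite !mulnBl [X in (_ <= X - _)%N]mulnC leq_sub2l// leq_mul2l lN orbT.
have := leq_mul IH H; lia.
Qed.

Lemma bin_cross_leq (l N j : nat) : (l <= N)%N ->
  ('C(l, j) * N ^ j <= 'C(N, j) * l ^ j)%N.
Proof.
move=> lN; rewrite -(leq_pmul2l (fact_gt0 j)) !mulnA ![(j`! * _)%N]mulnC.
by rewrite !bin_ffact; exact: ffact_cross_leq.
Qed.

Lemma bin_trinomial (N k j : nat) : (j <= k)%N -> (k <= N)%N ->
  ('C(N, k) * 'C(k, j) = 'C(N, j) * 'C(N - j, k - j))%N.
Proof.
move=> jk kN.
have f0 : (0 < k`! * j`! * (k - j)`! * (N - k)`!)%N by rewrite !muln_gt0 !fact_gt0.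
apply/eqP; rewrite -(eqn_pmul2l f0); apply/eqP.
have e1 := bin_fact kN.
have e2 := bin_fact jk.
have e3 := bin_fact (leq_trans jk kN).
have e4 := @bin_fact (N - j) (k - j) (leq_sub2r _ kN).
have e5 : (N - j - (k - j) = N - k)%N by lia.
rewrite e5 in e4.
transitivity (k`! * N`!)%N; first by rewrite -[in RHS]e1 -[X in (X * _)%N = _]mulnA; nia.
rewrite -[in LHS]e3 -e4; nia.
Qed.

Section hypergeometric.
Variables (R : realType) (I : finType).
Implicit Types K L J : {set I}.

(** Removing [J] is injective on its supersets. The boolean factor matters: for [#|J| > k] the
    truncated [k - #|J|] is 0 and the binomial coefficient alone would be 1. *)
Lemma card_supersets_leq J k : 
  (#|[set K : {set I} | #|K| == k & J \subset K]%SET| <=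
   (#|J| <= k) * 'C(#|I| - #|J|, k - #|J|))%N.
Proof.
have [Jk|kJ] := leqP #|J| k; last first.
  rewrite mul0n leqn0 cards_eq0; apply/eqP/setP => K; rewrite !inE.
  by apply/negbTE/negP => /andP[/eqP Kk /subset_leq_card]; rewrite Kk leqNgt kJ.
rewrite mul1n -(cardsC J) addKn -cards_draws.
pose f K : {set I} := (K :\: J)%SET.
rewrite -(card_in_imset (f := f)); last first.
  move=> K K'; rewrite !inE => /andP[_ JK] /andP[_ JK'] fE.
  by rewrite -(finset.setID K J) -(finset.setID K' J) -/(f K) fE (finset.setIidPr JK) (finset.setIidPr JK').
apply: subset_leq_card; apply/fintype.subsetP => _ /imsetP[K + ->].
rewrite !inE => /andP[/eqP <- JK]; rewrite /f cardsD (finset.setIidPr JK) eqxx andbT.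
by rewrite finset.setDE finset.subsetIr.
Qed.

Lemma sum_subsets (L : {set I}) (F : nat -> R) :
  \sum_(J : {set I} | J \subset L) F #|J| = \sum_(j < #|I|.+1) 'C(#|L|, j)%:R * F j.
Proof.
rewrite (partition_big (fun J : {set I} => inord #|J| : 'I_#|I|.+1) predT)//=.
apply: eq_bigr => j _.
rewrite (eq_bigr (fun=> F j)).
  rewrite sumr_const -cards_draws mulr_natl; congr (_ *+ _).
  apply: eq_card => J; rewrite !inE; congr andb.
  by rewrite -val_eqE/= inordK// ltnS max_card.
by move=> J /andP[_ /eqP <-]; rewrite inordK// ltnS max_card.
Qed.

Lemma pow_card_subsets (L : {set I}) (z : R) :
  (1 + z) ^+ #|L| = \sum_(J : {set I} | J \subset L) z ^+ #|J|.
Proof.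
rewrite sum_subsets addrC exprD1n.
rewrite (big_ord_widen_cond #|I|.+1 predT (fun i => z ^+ i *+ 'C(#|L|, i))); last first.
  by rewrite ltnS max_card.
rewrite big_mkcond/=; apply: eq_bigr => j _; rewrite mulr_natl.
by case: ltnP => // Lj; rewrite bin_small// mulr0n.
Qed.

(** The generating function of the hypergeometric law is dominated by that of the binomial law with
    the same mean. Expanding [(1 + z)^#|L :&: K|] over the subsets [J] of [L :&: K] and exchanging
    the sums leaves a comparison coefficient by coefficient. *)
Lemma sum_pow_cardI_le (L : {set I}) (z : R) (k : nat) :
  0 <= z -> (k <= #|I|)%N -> (0 < #|I|)%N ->
  \sum_(K : {set I} | #|K| == k) (1 + z) ^+ #|L :&: K| <=
  'C(#|I|, k)%:R * (1 + z * (#|L|%:R / #|I|%:R)) ^+ k.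
Proof.
move=> z0 kN N0; set N := #|I| in kN N0 *; set l := #|L|.
have N0' : (N%:R : R) != 0 by rewrite pnatr_eq0 -lt0n.
pose c j := (j <= k)%N%:R * 'C(N - j, k - j)%:R : R.
apply: (@le_trans _ _ (\sum_(J : {set I} | J \subset L) z ^+ #|J| * c #|J|)).
  under eq_bigr do rewrite pow_card_subsets.
  rewrite (exchange_big_dep (fun J : {set I} => J \subset L))/=; last first.
    by move=> K J _; rewrite finset.subsetI => /andP[].
  apply: ler_sum => J JL.
  rewrite sumr_const -[X in X <= _]mulr_natr ler_wpM2l ?exprn_ge0// /c -natrM ler_nat.
  apply: leq_trans (card_supersets_leq J k); apply/eq_leq/eq_card => K.
  by rewrite !inE unfold_in finset.subsetI JL.
rewrite (sum_subsets L (fun j => z ^+ j * c j)).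
rewrite addrC exprD1n mulr_sumr.
rewrite (big_ord_widen_cond #|I|.+1 predT
  (fun i => 'C(N, k)%:R * ((z * (l%:R / N%:R)) ^+ i *+ 'C(k, i)))) ?ltnS//.
rewrite [leRHS]big_mkcond/=; apply: ler_sum => j _; rewrite /c ltnS.
case: leqP => jk; last by rewrite mul0r !mulr0.
rewrite mul1r -[X in _ <= _ * X]mulr_natr exprMn expr_div_n.
rewrite [leLHS](_ : _ = z ^+ j * ('C(l, j) * 'C(N - j, k - j))%:R); last by rewrite natrM; ring.
rewrite [leRHS](_ : _ = z ^+ j * (('C(N, k) * 'C(k, j))%:R *
  (l%:R ^+ j / N%:R ^+ j))); last by rewrite natrM; ring.
rewrite ler_wpM2l ?exprn_ge0// mulrA ler_pdivlMr ?exprn_gt0 ?ltr0n//.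
(* Trinomial revision cancels ['C(N - j, k - j)]; what is left is sampling without against sampling
   with replacement, [bin_cross_leq]. *)
rewrite bin_trinomial// -!natrX -!natrM ler_nat.
have := @bin_cross_leq l N j (max_card _); move: ('C(N - j, k - j)) => x.
nia.
Qed.

End hypergeometric.

Section hypergeometric_tails.
Variables (R : realType) (I : finType) (a k : nat) (K : {set I}).
Hypotheses (a0 : (0 < a)%N) (k0 : (0 < k)%N) (cI : #|I| = (a * k)%N) (cK : #|K| = k).

Lemma expR_quarter_ge1 : 1 <= expR (1 / 4 : R).
Proof. by apply: le_trans (expR_ge1Dx _); lra. Qed.

(** Squaring [exp (-1/8) >= 7/8] gives [64/49]. The value [21/16] is rounded so that the upper tail
    sees [exp (1/4) - 1 <= 5/16]. *)
Lemma expR_quarter_le : expR (1 / 4 : R) <= 21 / 16.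
Proof.
have : 7 / 8 <= expR (- (1 / 8) : R) by apply: le_trans (expR_ge1Dx _); lra.
have e : expR (1 / 4 : R) * (expR (- (1 / 8)) * expR (- (1 / 8))) = 1.
  by rewrite -!expRD -expR0; congr expR; lra.
have := expR_gt0 (- (1 / 8) : R); have := expR_gt0 (1 / 4 : R); nra.
Qed.

Lemma expRN_quarter_le : expR (- (1 / 4) : R) <= 13 / 16.
Proof.
have : 9 / 8 <= expR (1 / 8 : R) by apply: le_trans (expR_ge1Dx _); lra.
have e : expR (- (1 / 4) : R) * (expR (1 / 8) * expR (1 / 8)) = 1.
  by rewrite -!expRD -expR0; congr expR; lra.
have := expR_gt0 (- (1 / 4) : R); have := expR_gt0 (1 / 8 : R); nra.
Qed.

(* Markov's inequality for [exp (#|L :&: K'| / 4)]. *)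
Lemma card_large_intersection_le (L : {set I}) (x : R) (Q : pred {set I}) :
  (forall K' : {set I}, #|K'| == k -> Q K' -> x <= #|L :&: K'|%:R) ->
  #|[set K' : {set I} | (#|K'| == k) && Q K']%SET|%:R <=
    expR (- (x / 4)) * ('C(a * k, k)%:R *
      (1 + (expR (1 / 4) - 1) * (#|L|%:R / (a * k)%:R)) ^+ k).
Proof.
move=> Qx.
have e1 : 0 <= expR (1 / 4) - 1 :> R by rewrite subr_ge0 expR_quarter_ge1//.
have := sum_pow_cardI_le L e1 (k := k).
rewrite cI leq_pmull// => /(_ isT); rewrite muln_gt0 a0 k0 => /(_ isT).
move=> /(ler_wpM2l (expR_ge0 (- (x / 4)))); apply: le_trans.
rewrite mulr_sumr -sum1dep_card natr_sum.
rewrite [leRHS](bigID Q)/= -[leLHS]addr0 lerD//.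
  apply: ler_sum => K' /andP[kK' QK'].
  rewrite addrC subrK -expRM_natl -expRD.
  apply: (@le_trans _ _ (expR 0)); first by rewrite expR0.
  by rewrite ler_expR; have := Qx _ kK' QK'; lra.
by apply: sumr_ge0 => K' _; rewrite mulr_ge0 ?expR_ge0 ?exprn_ge0// addrC subrK expR_ge0.
Qed.

(** The threshold is [3/2] of the mean [k / a]. Markov contributes the exponent [-3/8] and the
    generating function at most [5/16], in units of [k / a]; their sum is [-1/16]. *)
Lemma card_intersection_upper_tail :
  #|[set K' : {set I} | (#|K'| == k) && (3 * k < 2 * a * #|K :&: K'|)%N]%SET|%:R <=
  'C(a * k, k)%:R * expR (- (k%:R / (16 * a%:R))) :> R.
Proof.
have aR : (0 : R) < a%:R by rewrite ltr0n.
have kR : (0 : R) < k%:R by rewrite ltr0n.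
apply: le_trans (@card_large_intersection_le K (3 * k%:R / (2 * a%:R)) _ _) _.
  move=> K' _; rewrite ler_pdivrMr ?mulr_gt0// -[3]/(3%:R) -[2]/(2%:R) -!natrM ler_nat => ?.
  by rewrite [leqRHS]mulnC ltnW.
rewrite cK mulrCA ler_wpM2l//.
have -> : k%:R / (a * k)%:R = a%:R^-1 :> R.
  by rewrite natrM invfM mulrCA divff ?mulr1// gt_eqF.
set u := (_ - 1) / _.
have -> : expR (- (k%:R / (16 * a%:R))) =
  expR (- (3 * k%:R / (2 * a%:R) / 4)) * expR (k%:R * (5 / 16 / a%:R)) :> R.
  by rewrite -expRD; congr expR; field; rewrite gt_eqF.
rewrite ler_wpM2l ?expR_ge0// expRM_natl lerXn2r ?nnegrE ?expR_ge0//.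
  by rewrite addr_ge0// /u mulr_ge0 ?invr_ge0 ?(ltW aR)// subr_ge0 expR_quarter_ge1.
apply: le_trans (expR_ge1Dx _); rewrite lerD2l /u ler_wpM2r ?invr_ge0 ?(ltW aR)//.
have := expR_quarter_le; lra.
Qed.

(** A small [K :&: K'] is a large intersection of [K'] with the complement of [K], so the same
    Markov bound applies with [L = ~: K] and threshold [k - k / (2 a)]. *)
Lemma card_intersection_lower_tail :
  #|[set K' : {set I} | (#|K'| == k) && (2 * a * #|K :&: K'| < k)%N]%SET|%:R <=
  'C(a * k, k)%:R * expR (- (k%:R / (16 * a%:R))) :> R.
Proof.
have aR : (0 : R) < a%:R by rewrite ltr0n.
have a1 : (1 : R) <= a%:R by rewrite ler1n.
have kR : (0 : R) < k%:R by rewrite ltr0n.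
have cKC : #|~: K| = (a * k - k)%N by rewrite cardsCs finset.setCK cK cI.
apply: le_trans (@card_large_intersection_le (~: K)%SET (k%:R - k%:R / (2 * a%:R)) _ _) _.
  move=> K' /eqP cK' lt.
  have : (#|K :&: K'| + #|~: K :&: K'|)%N = k.
    by rewrite -cK' -(cardsID K K') finset.setIC finset.setDE [(~: K :&: _)%SET]finset.setIC.
  move=> H; have : #|K :&: K'|%:R <= k%:R / (2 * a%:R) :> R.
    by rewrite ler_pdivlMr ?mulr_gt0// -[2]/(2%:R) -!natrM ler_nat [leqLHS]mulnC ltnW.
  by move: (k%:R / (2 * a%:R)) => u; rewrite -[in X in _ -> X]H natrD; lra.
rewrite cKC mulrCA ler_wpM2l//.
have -> : (a * k - k)%:R / (a * k)%:R = 1 - a%:R^-1 :> R.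
  rewrite natrB ?leq_pmull// natrM mulrBl divff ?mulf_neq0 ?gt_eqF//.
  by rewrite invfM mulrCA divff ?mulr1// gt_eqF.
set w := expR (1 / 4) : R.
have w0 : 0 < w by exact: expR_gt0.
have wi : w^-1 <= 13 / 16 by rewrite -expRN expRN_quarter_le.
have -> : expR (- (k%:R / (16 * a%:R))) =
  expR (- ((k%:R - k%:R / (2 * a%:R)) / 4)) * expR (k%:R * (1 / 4 - 3 / 16 / a%:R)) :> R.
  by rewrite -expRD; congr expR; field; rewrite gt_eqF.
have ai1 : a%:R^-1 <= 1 :> R by rewrite invf_le1.
have ai0 : 0 < a%:R^-1 :> R by rewrite invr_gt0.
have w1 : 1 <= w by rewrite expR_quarter_ge1.
rewrite ler_wpM2l ?expR_ge0// expRM_natl lerXn2r ?nnegrE ?expR_ge0//.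
  by rewrite addr_ge0// mulr_ge0// subr_ge0.
rewrite expRD -/w.
have : 1 - 3 / 16 / a%:R <= expR (- (3 / 16 / a%:R)) :> R by exact: expR_ge1Dx.
move=> /(ler_wpM2l (ltW w0)); apply: le_trans.
have ww : w * w^-1 = 1 by rewrite divff// gt_eqF.
(* With [b = 1 / a] the goal is [1 + (w - 1) (1 - b) <= w (1 - 3 b / 16)], that is
   [3 w / 16 <= w - 1]. *)
have : 16 <= 13 * w by rewrite -(ler_pM2r (x := w^-1)) ?invr_gt0// -mulrA ww; lra.
move: (a%:R^-1) ai1 ai0 => b; nra.
Qed.

End hypergeometric_tails.

(** * Densities and Gaussian windows *)

Section densities.
Context {d : measure_display} {T : measurableType d} {R : realType}.
Variable P : probability T R.
Implicit Types X : {RV P >-> R}.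
Local Notation mu := (@lebesgue_measure R).

(** [has_density] speaks of sets only. The law of [X] is dominated by Lebesgue measure, its
    Radon-Nikodym derivative is almost everywhere [f], and the change of variables formula passes to
    functions [h]. *)
Lemma integral_density X f (h : R -> R) : has_density X f ->
  measurable_fun setT h -> (forall x, 0 <= h x) ->
  (\int[P]_t (h (X t))%:E = \int[mu]_x (h x * f x)%:E)%E.
Proof.
move=> [mf f0 Xf] mh h0.
(* Lebesgue measure lives on [measurableTypeR R], which has the same measurable
   sets as [R] but another display: [X] has to be repackaged. *)
have mX : measurable_fun setT (X : T -> measurableTypeR R).
  by move=> mT B mB; have : measurable_fun setT X by []; exact: (fun H => H mT B mB).
pose Y : {mfun T >-> measurableTypeR R} :=
  @mfun_Sub _ _ T (measurableTypeR R) _ (mem_set mX).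
pose nu : {finite_measure set (measurableTypeR R) -> \bar R} := distribution P Y.
have nuE A : measurable A -> nu A = (\int[mu]_(x in A) (f x)%:E)%E by exact: Xf.
have nu_mu : nu `<< mu.
  apply/null_content_dominatesP => A mA muA0; rewrite nuE//.
  apply: null_set_integral => //; apply/measurable_EFinP.
  exact: measurable_funTS.
have mh' : measurable_fun setT (EFin \o (h : measurableTypeR R -> R)).
  exact/measurable_EFinP.
have mf' : measurable_fun setT (EFin \o (f : measurableTypeR R -> R)).
  exact/measurable_EFinP.
transitivity (\int[nu]_x (h x)%:E)%E.
  by rewrite (ge0_integral_distribution Y mh')// => x; rewrite lee_fin.
rewrite -(Radon_Nikodym_SigmaFinite.change_of_variables nu_mu)//.
have RNint := Radon_Nikodym_SigmaFinite.f_integrable nu_mu.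
apply: ae_eq_integral => //.
- by apply: emeasurable_funM => //; exact: measurable_int RNint.
- by apply/measurable_EFinP; exact: measurable_funM.
under [X in ae_eq _ _ _ X]eq_fun do rewrite EFinM.
apply: ae_eqe_mul2l; apply: integral_ae_eq => // E _ mE.
by rewrite -Radon_Nikodym_SigmaFinite.f_integral// nuE.
Qed.

Lemma window_preimage X (r y theta : R) : 0 < r ->
  [set t | `|r * X t - y| <= theta] = X @^-1` `[(y - theta) / r, (y + theta) / r].
Proof.
move=> r0; apply/seteqP; split => t /=; rewrite in_itv/= ler_pdivrMr// ler_pdivlMr// ler_norml;
  move=> /andP[? ?]; apply/andP; split; lra.
Qed.

Lemma density_window_le X f (r y theta b : R) : has_density X f ->
  0 < r -> 0 < theta -> (forall x, `|x - y / r| <= theta / r -> f x <= b) ->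
  (P [set t | (`|r * X t - y| <= theta)%R] <= (2 * theta / r * b)%:E)%E.
Proof.
move=> [mf f0 Xf] r0 t0 fb.
rewrite window_preimage// -[leLHS]/(distribution P X _) Xf//.
have uv : (y - theta) / r <= (y + theta) / r by rewrite ler_pM2r ?invr_gt0//; lra.
set I := `[_, _]%classic.
have mI : measurable (I : set (measurableTypeR R)) by exact: measurable_itv.
have muI : mu I = (2 * theta / r)%:E.
  rewrite /I lebesgue_measure_itv/= lte_fin ltr_pM2r ?invr_gt0//.
  rewrite (_ : y - theta < y + theta); last by lra.
  by rewrite -EFinB; congr EFin; field; rewrite gt_eqF.
apply: (@le_trans _ _ (\int[mu]_(x in I) b%:E)%E); last first.
  rewrite integral_cst//.
  by move: muI => /(congr1 (fun u => b%:E * u)%E) /= ->; rewrite -EFinM mulrC.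
apply: ge0_le_integral => //=.
- by move=> x _; rewrite lee_fin.
- exact/measurable_EFinP/measurable_funTS.
move=> x; rewrite /I /= in_itv/= !mulrDl mulNr => xuv.
by rewrite lee_fin; apply: fb; rewrite ler_distl; lra.
Qed.

Lemma density_window_ge X f (r y theta b : R) : has_density X f ->
  0 < r -> 0 < theta -> (forall x, `|x - y / r| <= theta / r -> b <= f x) ->
  ((2 * theta / r * b)%:E <= P [set t | (`|r * X t - y| <= theta)%R])%E.
Proof.
move=> [mf f0 Xf] r0 t0 fb.
(* [b] will be a Gaussian density minus an error and may be negative, whereas the comparison of
   integrals below wants nonnegative functions. *)
have [b0|b0] := leP b 0.
  apply: le_trans (measure_ge0 _ _); rewrite lee_fin.
  by rewrite mulr_ge0_le0// divr_ge0 ?mulr_ge0// ltW.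
rewrite window_preimage// -[leRHS]/(distribution P X _) Xf//.
set I := `[_, _]%classic.
have mI : measurable (I : set (measurableTypeR R)) by exact: measurable_itv.
have muI : mu I = (2 * theta / r)%:E.
  rewrite /I lebesgue_measure_itv/= lte_fin ltr_pM2r ?invr_gt0//.
  rewrite (_ : y - theta < y + theta); last by lra.
  by rewrite -EFinB; congr EFin; field; rewrite gt_eqF.
apply: (@le_trans _ _ (\int[mu]_(x in I) b%:E)%E).
  rewrite integral_cst//.
  by move: muI => /(congr1 (fun u => b%:E * u)%E) /= ->; rewrite -EFinM mulrC.
apply: ge0_le_integral => //=.
- by move=> x _; rewrite lee_fin ltW.
- exact/measurable_EFinP/measurable_funTS.
move=> x; rewrite /I /= in_itv/= !mulrDl mulNr => xuv.
by rewrite lee_fin; apply: fb; rewrite ler_distl; lra.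
Qed.

End densities.

Section gaussian.
Context {R : realType}.
Local Notation phi := (normal_pdf (0 : R) 1).
Local Notation c := ((Num.sqrt (2 * pi : R))^-1).

Lemma std_normal_pdfE x : phi x = c * expR (- (x ^+ 2 / 2)).
Proof.
rewrite normal_pdfE ?oner_neq0// /normal_peak /normal_fun.
rewrite expr1n mul1r subr0 -mulr_natl; congr (_ * expR _).
by rewrite -mulr_natl mulr1 mulNr.
Qed.

Lemma normal_pdf_scaled m s x : 0 < s ->
  s * normal_pdf m s x = phi ((x - m) / s).
Proof.
move=> s0; rewrite std_normal_pdfE normal_pdfE ?gt_eqF// /normal_peak /normal_fun.
rewrite -mulrnAr sqrtrM ?sqr_ge0// sqrtr_sqr gtr0_norm// -mulr_natl.
rewrite invfM mulrA mulVKf ?gt_eqF//; congr (_ * expR _).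
by rewrite -mulr_natl; field; rewrite gt_eqF.
Qed.

Lemma sqrt2pi_gt0 : 0 < Num.sqrt (2 * pi : R).
Proof. by rewrite sqrtr_gt0 mulr_gt0// pi_gt0. Qed.

Lemma sqr_inv_sqrt2pi : c ^+ 2 = (2 * pi)^-1.
Proof. by rewrite exprVn sqr_sqrtr// mulr_ge0// pi_ge0. Qed.

Lemma inv_sqrt2pi_le : c <= 1 / 2.
Proof.
have c0 : 0 < c by rewrite invr_gt0 sqrt2pi_gt0.
have : c ^+ 2 <= 1 / 4.
  rewrite sqr_inv_sqrt2pi -[leRHS]invrK lef_pV2 ?posrE.
  - by have := pi_ge2 R; lra.
  - by rewrite mulr_gt0// pi_gt0.
  - by rewrite invr_gt0; lra.
nra.
Qed.

Lemma std_normal_pdf_le x : phi x <= 1 / 2.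
Proof.
rewrite std_normal_pdfE; have := inv_sqrt2pi_le; apply: le_trans.
rewrite ler_piMr ?invr_ge0 ?sqrtr_ge0// expR_le1 oppr_le0.
by rewrite divr_ge0 ?sqr_ge0.
Qed.

(** Controls the variation of the density across a window. The crude constant 1 suffices: by
    evenness one may take [0 <= y <= x]; the peak is at most [1/2], so gaps [x - y >= 1] are
    immediate, and for smaller gaps [1 - exp (-t) <= t] gives slope at most [3/2] before the factor
    [1/2]. *)
Lemma std_normal_pdf_lipschitz x y : `|phi x - phi y| <= `|x - y|.
Proof.
wlog xy : x y / `|y| <= `|x| => [H|].
  have [/H//|/ltW/H] := leP `|y| `|x|.
  by rewrite distrC [leRHS]distrC.
have c0 : 0 < c by rewrite invr_gt0 sqrt2pi_gt0.
have c1 := inv_sqrt2pi_le.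
apply: (@le_trans _ _ (`|x| - `|y|)); last first.
  by apply: le_trans (ler_dist_dist x y); exact: ler_norm.
have phiN z : phi z = c * expR (- (`|z| ^+ 2 / 2)) by rewrite real_normK ?num_real// std_normal_pdfE.
rewrite !phiN; move: `|x| `|y| (normr_ge0 y) xy => {}x {}y y0 xy.
have ey := expR_gt0 (- (y ^+ 2 / 2)).
have eyx : expR (- (x ^+ 2 / 2)) = expR (- (y ^+ 2 / 2)) * expR (- ((x ^+ 2 - y ^+ 2) / 2)).
  by rewrite -expRD; congr expR; lra.
have e1 := expR_ge1Dx (- ((x ^+ 2 - y ^+ 2) / 2)).
have e2 : expR (- (y ^+ 2 / 2)) * (1 + y ^+ 2 / 2) <= 1.
  by rewrite expRN ler_pdivrMl ?expR_gt0// mulr1 expR_ge1Dx.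
have e3 : 0 <= expR (- (x ^+ 2 / 2)) by exact: expR_ge0.
have e4 : expR (- (x ^+ 2 / 2)) <= expR (- (y ^+ 2 / 2)).
  by rewrite ler_expR; nra.
have ey1 : expR (- (y ^+ 2 / 2)) <= 1 by rewrite expR_le1; nra.
rewrite -mulrBr normrM gtr0_norm// distrC ger0_norm ?subr_ge0//.
have [d1|d1] := leP 1 (x - y); first by nra.
rewrite eyx in e3 e4 *.
move: (expR (- (y ^+ 2 / 2))) ey e2 ey1 e1 e3 e4 => g ey e2 ey1 e1 e3 e4.
(* From [g (1 + y^2 / 2) <= 1] and [y <= 1 + y^2 / 2]. *)
have gy : g * y <= 1 by nra.
have : g - g * expR (- ((x ^+ 2 - y ^+ 2) / 2)) <= g * ((x - y) * (2 * y + (x - y)) / 2) by nra.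
have gd : g * (x - y) <= 1 by nra.
have : (x - y) * (g * y + g * (x - y) / 2) <= (x - y) * (3 / 2).
  by rewrite ler_wpM2l ?subr_ge0//; lra.
nra.
Qed.

End gaussian.

Lemma measurable_sqr_std_normal_affine {R : realType} (x y z : R) :
  measurable_fun setT (fun w : R => normal_pdf (0 : R) 1 ((x - y * w) / z) ^+ 2).
Proof.
apply: measurable_funX; apply: (measurableT_comp (measurable_normal_pdf _ _)).
by apply: measurable_funM => //; exact: measurable_funB.
Qed.

(** * Windows of nearly Gaussian variables *)

Section near_normal.
Context {d : measure_display} {T : measurableType d} {R : realType}.
Variable P : probability T R.
Implicit Types X Y Z : {RV P >-> R}.
Local Notation mu := (@lebesgue_measure R).
Local Notation phi := (normal_pdf (0 : R) 1).

(** The form in which Gaussian convergence is used, with [b = gamma / n] for a normalized sum of [n]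
    terms. *)
Definition near_normal X (b : R) :=
  exists2 f, has_density X f & forall x, `|f x - phi x| <= b.

Lemma near_normal_window_le X b r y theta : near_normal X b -> 0 < r -> 0 < theta ->
  (P [set t | (`|r * X t - y| <= theta)%R] <=
   (2 * theta / r * (phi (y / r) + (b + theta / r)))%:E)%E.
Proof.
move=> [f Xf fphi] r0 t0; apply: (density_window_le Xf) => // x xw.
have := fphi x; rewrite ler_distl => /andP[_ fx].
have := std_normal_pdf_lipschitz x (y / r); rewrite ler_distl => /andP[_].
lra.
Qed.

Lemma near_normal_window_ge X b r y theta : near_normal X b -> 0 < r -> 0 < theta ->
  ((2 * theta / r * (phi (y / r) - (b + theta / r)))%:E <=
   P [set t | (`|r * X t - y| <= theta)%R])%E.
Proof.
move=> [f Xf fphi] r0 t0; apply: (density_window_ge Xf) => // x xw.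
have := fphi x; rewrite ler_distl => /andP[fx _].
have := std_normal_pdf_lipschitz x (y / r); rewrite ler_distl => /andP[+ _].
lra.
Qed.

(* Completing the square; the leftover factor [exp (- D^2 / (rn^2 + 2 rs^2))] is
   bounded by 1. *)
Lemma std_normal_pdf_sqr_mul_le (rs rn D x : R) : 0 < rs -> 0 < rn ->
  phi ((D - rs * x) / rn) ^+ 2 * phi x <=
  rn / Num.sqrt (rn ^+ 2 + 2 * rs ^+ 2) / (2 * pi) *
  normal_pdf (2 * D * rs / (rn ^+ 2 + 2 * rs ^+ 2))
    (rn / Num.sqrt (rn ^+ 2 + 2 * rs ^+ 2)) x.
Proof.
move=> s0 n0; set q := rn ^+ 2 + 2 * rs ^+ 2.
have q0 : 0 < q by rewrite /q; nra.
have sq0 : 0 < Num.sqrt q by rewrite sqrtr_gt0.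
have sqE : Num.sqrt q ^+ 2 = q by rewrite sqr_sqrtr// ltW.
rewrite [leRHS]mulrAC normal_pdf_scaled ?divr_gt0// !std_normal_pdfE.
rewrite exprMn sqr_inv_sqrt2pi.
set cc := (Num.sqrt _)^-1; set p := (2 * pi)^-1.
rewrite [leRHS](_ : _ = p * cc *
  expR (- (((x - 2 * D * rs / q) / (rn / Num.sqrt q)) ^+ 2 / 2))); last by ring.
rewrite [leLHS](_ : _ = p * cc *
  (expR (- (((D - rs * x) / rn) ^+ 2 / 2)) ^+ 2 * expR (- (x ^+ 2 / 2)))); last by ring.
rewrite ler_wpM2l ?mulr_ge0 ?invr_ge0 ?sqrtr_ge0 ?mulr_ge0 ?pi_ge0//.
rewrite -expRM_natl -expRD ler_expR.
have scale y w : w != 0 -> (y / (rn / w)) ^+ 2 / 2 = y ^+ 2 * w ^+ 2 / (2 * rn ^+ 2).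
  by move=> w0; field; rewrite w0 gt_eqF.
rewrite scale ?gt_eqF// sqE.
rewrite -subr_ge0 (_ : _ - _ = D ^+ 2 / q).
  by rewrite divr_ge0 ?sqr_ge0// ltW.
by rewrite /q; field; rewrite -/q !gt_eqF.
Qed.

(** The density of [X] is at most [phi + bs]. The [phi] part is [std_normal_pdf_sqr_mul_le]; the
    constant [bs] stays integrable against [phi(...)^2 <= phi(...) / 2], a Gaussian bump of total
    mass [rn / rs] before halving. This is the amplification of [bs]. *)
Lemma integral_sqr_std_normal_le X (bs rs rn D : R) : near_normal X bs -> 0 <= bs ->
  0 < rs -> 0 < rn ->
  (\int[P]_t (phi ((D - rs * X t) / rn) ^+ 2)%:E <=
   (rn / Num.sqrt (rn ^+ 2 + 2 * rs ^+ 2) / (2 * pi) + bs / 2 * (rn / rs))%:E)%E.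
Proof.
move=> [f Xf fphi] bs0 s0 n0.
set al := _ / (2 * pi); set be := bs / 2 * _.
set m1 := 2 * D * rs / (rn ^+ 2 + 2 * rs ^+ 2).
set s1 := rn / Num.sqrt (rn ^+ 2 + 2 * rs ^+ 2).
have al0 : 0 <= al by rewrite /al !divr_ge0 ?sqrtr_ge0 ?mulr_ge0 ?pi_ge0// ltW.
have be0 : 0 <= be by rewrite /be !mulr_ge0 ?invr_ge0// ltW.
have mphi := measurable_sqr_std_normal_affine D rs rn.
rewrite (integral_density (h := fun x => phi ((D - rs * x) / rn) ^+ 2) Xf)//; last first.
  by move=> x; exact: sqr_ge0.
have [mf f0 _] := Xf.
apply: (@le_trans _ _ (\int[mu]_x (al%:E * (normal_pdf m1 s1 x)%:E +
    be%:E * (normal_pdf (D / rs) (rn / rs) x)%:E)))%E.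
  apply: ge0_le_integral => //.
  - by move=> x _; rewrite lee_fin mulr_ge0 ?sqr_ge0.
  - by apply/measurable_EFinP; exact: measurable_funM.
  - apply: emeasurable_funD; apply: emeasurable_funM => //;
      apply/measurable_EFinP; exact: measurable_normal_pdf.
  move=> x _; rewrite -!EFinM -EFinD lee_fin.
  apply: (@le_trans _ _ (phi ((D - rs * x) / rn) ^+ 2 * phi x +
     phi ((D - rs * x) / rn) ^+ 2 * bs)).
    rewrite -mulrDr ler_wpM2l ?sqr_ge0//.
    by have := fphi x; rewrite ler_distl => /andP[_].
  apply: lerD; first exact: std_normal_pdf_sqr_mul_le.
  rewrite /be -[leRHS]mulrA normal_pdf_scaled ?divr_gt0//.
  have -> : (x - D / rs) / (rn / rs) = - ((D - rs * x) / rn).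
    by field; rewrite !gt_eqF.
  have -> : phi (- ((D - rs * x) / rn)) = phi ((D - rs * x) / rn).
    by rewrite !std_normal_pdfE sqrrN.
  have := std_normal_pdf_le ((D - rs * x) / rn).
  have := normal_pdf_ge0 0 1 ((D - rs * x) / rn).
  move: (phi _) => u u0 u1; have : u * u <= u / 2 by nra.
  rewrite expr2; nra.
rewrite ge0_integralD//; last 4 first.
- by move=> x _; rewrite -EFinM lee_fin mulr_ge0// normal_pdf_ge0.
- apply: emeasurable_funM => //; apply/measurable_EFinP; exact: measurable_normal_pdf.
- by move=> x _; rewrite -EFinM lee_fin mulr_ge0// normal_pdf_ge0.
- apply: emeasurable_funM => //; apply/measurable_EFinP; exact: measurable_normal_pdf.
rewrite !ge0_integralZl//; try by move=> *; rewrite ?lee_fin ?normal_pdf_ge0.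
- by rewrite !integral_normal_pdf !mule1.
- apply/measurable_EFinP; exact: measurable_normal_pdf.
- apply/measurable_EFinP; exact: measurable_normal_pdf.
Qed.

(* [X], [Y], [Z] stand for the normalized sums over [K :&: K'], [K :\: K'] and
   [K' :\: K]. *)
Lemma pair_window_le X Y Z (bs bn rs rn D theta : R) :
  near_normal X bs -> near_normal Y bn -> near_normal Z bn ->
  (forall A B, measurable A -> measurable B ->
    P (X @^-1` A `&` (fun t => (Y t, Z t)) @^-1` B) =
    P (X @^-1` A) * P ((fun t => (Y t, Z t)) @^-1` B))%E ->
  (forall A B, measurable A -> measurable B ->
    P (Y @^-1` A `&` Z @^-1` B) = P (Y @^-1` A) * P (Z @^-1` B))%E ->
  0 <= bs -> 0 <= bn -> 0 < rs -> 0 < rn -> 0 < theta -> bn + theta / rn <= 1 ->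
  (P [set t | (`|rs * X t + rn * Y t - D| <= theta)%R /\
              (`|rs * X t + rn * Z t - D| <= theta)%R] <=
   ((2 * theta / rn) ^+ 2 * (rn / Num.sqrt (rn ^+ 2 + 2 * rs ^+ 2) / (2 * pi) +
      bs / 2 * (rn / rs) + 2 * (bn + theta / rn)))%:E)%E.
Proof.
move=> Xn Yn Zn XYZ YZ bs0 bn0 s0 n0 t0 e1.
set e := bn + theta / rn in e1 *.
have e0 : 0 <= e by rewrite addr_ge0// divr_ge0// ltW.
have mYZ : measurable_fun setT (fun t => (Y t, Z t)) by exact: measurable_fun_pair.
pose E := [set w : R * (R * R) | (`|rs * w.1 + rn * w.2.1 - D| <= theta)%R /\
              (`|rs * w.1 + rn * w.2.2 - D| <= theta)%R].
have mE : measurable E.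
  have mg (g : R * (R * R) -> R) : measurable_fun setT g ->
      measurable [set w | `|rs * w.1 + rn * g w - D| <= theta].
    move=> mg; rewrite -[X in measurable X]setTI.
    apply: (measurable_fun_le (f := fun w => `|rs * w.1 + rn * g w - D|) (g := fun=> theta)) => //.
    apply: measurableT_comp => //; apply: measurable_funB => //.
    by apply: measurable_funD; apply: measurable_funM.
  by apply: measurableI; apply: mg; apply: measurableT_comp.
rewrite -[X in P X]/[set t | E (X t, (Y t, Z t))] (indep_fubini _ mYZ XYZ mE)//.
(* Given [X], the two windows are independent, each bounded by [phi + e]; and
   [(phi + e)^2 <= phi^2 + 2 e] because [phi <= 1/2] and [e <= 1]. *)
pose h x := (2 * theta / rn) ^+ 2 * (phi ((D - rs * x) / rn) ^+ 2 + 2 * e).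
have step s : (P [set t | E (X s, (Y t, Z t))] <= (h (X s))%:E)%E.
  have -> : [set t | E (X s, (Y t, Z t))] =
     Y @^-1` [set y | `|rn * y - (D - rs * X s)| <= theta] `&`
     Z @^-1` [set y | `|rn * y - (D - rs * X s)| <= theta].
    have eE y : rn * y - (D - rs * X s) = rs * X s + rn * y - D by ring.
    by apply/seteqP; split => t; rewrite /E /= !eE.
  have mW : measurable [set y : R | `|rn * y - (D - rs * X s)| <= theta].
    rewrite -[X in measurable X]setTI.
    apply: (measurable_fun_le (f := fun y => `|rn * y - (D - rs * X s)|) (g := fun=> theta)) => //.
    apply: measurableT_comp => //; exact: measurable_funB.
  rewrite YZ//.
  have wY := near_normal_window_le (D - rs * X s) Yn n0 t0.
  have wZ := near_normal_window_le (D - rs * X s) Zn n0 t0.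
  apply: le_trans (lee_pmul _ _ wY wZ) _; rewrite ?measure_ge0//.
  rewrite -EFinM lee_fin /h mulrACA -!expr2 ler_wpM2l ?sqr_ge0// -/e.
  have := std_normal_pdf_le ((D - rs * X s) / rn).
  have := normal_pdf_ge0 0 1 ((D - rs * X s) / rn).
  move: (phi _) => u u0 u1; nra.
have mh := measurable_sqr_std_normal_affine D rs rn.
have mhX : measurable_fun setT (fun t => (phi ((D - rs * X t) / rn) ^+ 2)%:E).
  by apply/measurable_EFinP; exact: (measurableT_comp mh).
have th0 : (0 <= ((2 * theta / rn) ^+ 2)%:E)%E by rewrite lee_fin sqr_ge0.
have e0' : (0 <= (2 * e)%:E)%E by rewrite lee_fin mulr_ge0.
apply: (@le_trans _ _ (\int[P]_s (h (X s))%:E)%E).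
  apply: ge0_le_integral => //.
  - exact: measurable_section_probability.
  - apply/measurable_EFinP; apply: measurable_funM => //.
    by apply: measurable_funD => //; exact: (measurableT_comp mh).
rewrite /h; under eq_integral do rewrite EFinM EFinD.
rewrite ge0_integralZl//; last 2 first.
- exact: emeasurable_funD.
- by move=> x _; rewrite adde_ge0// lee_fin sqr_ge0.
rewrite ge0_integralD//; last by move=> x _; rewrite lee_fin sqr_ge0.
rewrite integral_cst//= probability_setT mule1 [leRHS]EFinM.
rewrite lee_wpmul2l ?lee_fin ?sqr_ge0// EFinD leeD2r//.
exact: integral_sqr_std_normal_le.
Qed.

End near_normal.

(** * Partial sums of independent variables *)

Section partial_sums.
Context {d : measure_display} {T : measurableType d} {R : realType}.
Variable P : probability T R.
Context {I : finType}.
Variable X : I -> {RV P >-> R}.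
Implicit Types K L : {set I}.

Lemma mutually_independent_inj (I' : finType) (h : I' -> I) : injective h ->
  mutually_independent X -> mutually_independent (X \o h).
Proof.
move=> hinj indX J A mA.
pose A' i := if [pick l | h l == i] is Some l then A l else setT.
have A'h l : A' (h l) = A l.
  rewrite /A'; case: pickP => [l' /eqP /hinj -> //|/(_ l)]; by rewrite eqxx.
have mA' i : measurable (A' i) by rewrite /A'; case: pickP.
have := indX (h @: J)%SET A' mA'.
rewrite big_imset/=; last by move=> ? ? _ _; exact: hinj.
rewrite (eq_bigr (fun l => P ((X \o h) l @^-1` A l))); last by move=> l _; rewrite A'h.
move=> <-; congr (P _); apply/seteqP; split => t tA i /=.
  by move=> /imsetP[l lJ ->]; rewrite A'h; exact: tA.
by move=> iJ; have := tA (h i) (imset_f _ iJ); rewrite A'h.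
Qed.

Definition set_sum K (t : T) : R := \sum_(j in K) X j t.

Lemma set_sum_enum K : set_sum K = fun t => \sum_(l < #|K|) X (enum_val l) t.
Proof. by apply/funext => t; rewrite /set_sum big_enum_val. Qed.

Lemma measurable_set_sum_cylinders K L : K \subset L ->
  measurable_fun setT (set_sum K : g_sigma_algebraType (cylinders X L) -> R).
Proof.
move=> /fintype.subsetP KL; rewrite set_sum_enum.
apply: measurable_sum => l.
exact: measurable_fun_cylinders (KL _ (enum_valP l)).
Qed.

Lemma measurable_set_sum K : measurable_fun setT (set_sum K).
Proof.
by rewrite set_sum_enum; exact: measurable_sum.
Qed.

(** Reindexed by [enum_val] because [gaussian_convergent] speaks of families over ['I_n]. *)
Definition normalized_set_sum K : {RV P >-> R} :=
  normalized_sum (fun l : 'I_#|K| => X (enum_val l)).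

Lemma set_sumE K t : (0 < #|K|)%N ->
  set_sum K t = Num.sqrt #|K|%:R * normalized_set_sum K t.
Proof.
move=> K0; rewrite /= /normalized_sum -mulr_suml mulrCA divff ?mulr1; last first.
  by rewrite gt_eqF// sqrtr_gt0 ltr0n.
by rewrite /set_sum big_enum_val.
Qed.

Definition window K (D theta : R) : set T := [set t | `|set_sum K t - D| <= theta].

Lemma cylinders_window K L (D theta : R) : K \subset L ->
  <<s cylinders X L >> (window K D theta).
Proof.
move=> KL.
have := @measurable_fun_le _ (g_sigma_algebraType (cylinders X L)) R _
  (fun t => `|set_sum K t - D|) (fun=> theta) measurableT.
rewrite setTI; apply => //; apply: measurableT_comp => //.
by apply: measurable_funB => //; exact: measurable_set_sum_cylinders.
Qed.

Hypothesis indX : mutually_independent X.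

Lemma indep_complementary_fun K d1 d2 (T1 : measurableType d1)
    (T2 : measurableType d2) (U : T -> T1) (V : T -> T2) :
  measurable_fun setT (U : g_sigma_algebraType (cylinders X K) -> T1) ->
  measurable_fun setT (V : g_sigma_algebraType (cylinders X (~: K)%SET) -> T2) ->
  forall A B, measurable A -> measurable B ->
  (P (U @^-1` A `&` V @^-1` B) = P (U @^-1` A) * P (V @^-1` B))%E.
Proof.
move=> mU mV A B mA mB; apply: (indep_complementary indX (K := K)).
  by have := mU measurableT A mA; rewrite setTI.
by have := mV measurableT B mB; rewrite setTI.
Qed.

Lemma measurable_normalized_set_sum K L : K \subset L ->
  measurable_fun setT (normalized_set_sum K : g_sigma_algebraType (cylinders X L) -> R).
Proof.
move=> KL.
have -> : normalized_set_sum K = (fun t => set_sum K t / Num.sqrt #|K|%:R) :> (T -> R).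
  by apply/funext => t; rewrite set_sum_enum mulr_suml.
by apply: measurable_funM => //; exact: measurable_set_sum_cylinders.
Qed.

(** The intersection and the two differences are disjoint blocks. Independence is taken twice: of
    the intersection from the pair of differences, then of the differences from each other. *)
Lemma overlapping_window_le K K' (s n : nat) (bs bn D theta : R) :
  #|(K :&: K')%SET| = s -> #|(K :\: K')%SET| = n -> #|(K' :\: K)%SET| = n ->
  (0 < s)%N -> (0 < n)%N ->
  near_normal (normalized_set_sum (K :&: K')%SET) bs ->
  near_normal (normalized_set_sum (K :\: K')%SET) bn ->
  near_normal (normalized_set_sum (K' :\: K)%SET) bn ->
  0 <= bs -> 0 <= bn -> 0 < theta -> bn + theta / Num.sqrt n%:R <= 1 ->
  (P (window K D theta `&`
      window K' D theta) <=
   ((2 * theta) ^+ 2 / n%:R *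
      (Num.sqrt (n%:R / (n%:R + 2 * s%:R)) / (2 * pi) +
       bs / 2 * Num.sqrt (n%:R / s%:R) + 2 * (bn + theta / Num.sqrt n%:R)))%:E)%E.
Proof.
move=> cs cn cn' s0 n0 nX nY nZ bs0 bn0 t0 e1.
have rs0 : 0 < Num.sqrt s%:R :> R by rewrite sqrtr_gt0 ltr0n.
have rn0 : 0 < Num.sqrt n%:R :> R by rewrite sqrtr_gt0 ltr0n.
have := pair_window_le D nX nY nZ _ _ bs0 bn0 rs0 rn0 t0 e1.
have sub1 : (K :\: K')%SET \subset (~: (K :&: K'))%SET.
  by apply/fintype.subsetP => j; rewrite !inE => /andP[/negbTE ->]; rewrite andbF.
have sub2 : (K' :\: K)%SET \subset (~: (K :&: K'))%SET.
  by apply/fintype.subsetP => j; rewrite !inE => /andP[/negbTE ->].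
have sub3 : (K' :\: K)%SET \subset (~: (K :\: K'))%SET.
  by apply/fintype.subsetP => j; rewrite !inE => /andP[/negbTE ->]; rewrite andbF.
have HXYZ := indep_complementary_fun
  (measurable_normalized_set_sum (fintype.subxx (K :&: K')%SET))
  (measurable_fun_pair (measurable_normalized_set_sum sub1) (measurable_normalized_set_sum sub2)).
have HYZ := indep_complementary_fun
  (measurable_normalized_set_sum (fintype.subxx (K :\: K')%SET))
  (measurable_normalized_set_sum sub3).
move=> /(_ HXYZ HYZ).
have sqrtr_div (x y : R) : 0 <= x -> 0 <= y -> Num.sqrt (x / y) = Num.sqrt x / Num.sqrt y.
  by move=> x0 y0; rewrite sqrtrM// sqrtrV.
rewrite expr_div_n !sqr_sqrtr ?ler0n// !sqrtr_div ?addr_ge0 ?mulr_ge0 ?ler0n//.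
apply: le_trans.
rewrite le_eqVlt; apply/orP; left; apply/eqP; congr (P _).
have splitK L L' t : (0 < #|(L :&: L')%SET|)%N -> (0 < #|(L :\: L')%SET|)%N ->
    set_sum L t = Num.sqrt #|(L :&: L')%SET|%:R * normalized_set_sum (L :&: L')%SET t +
      Num.sqrt #|(L :\: L')%SET|%:R * normalized_set_sum (L :\: L')%SET t.
  by move=> ? ?; rewrite -!set_sumE// /set_sum (big_setID L').
have eK t := splitK K K' t; have eK' t := splitK K' K t.
rewrite cs cn in eK; rewrite finset.setIC cs cn' in eK'.
by apply/seteqP; split => t; rewrite /window /= eK// eK'.
Qed.

(* Condition on all the variables but [X j]. *)
Lemma distinct_window_le K K' j (D theta q : R) : j \in K' -> j \notin K ->
  (forall y, P [set t | (`|X j t - y| <= theta)%R] <= q%:E)%E -> 0 <= q ->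
  (P (window K D theta `&`
      window K' D theta) <=
   P (window K D theta) * q%:E)%E.
Proof.
move=> jK' jK Xjq q0.
(* [U] holds all that the windows depend on besides [X j]. The first window is a function of [U]
   alone, so freezing [U] leaves its indicator times a window of [X j] with a shifted centre. *)
pose U t := (set_sum K t, set_sum (K' :\ j)%SET t).
pose E := [set w : (R * R) * R | `|w.1.1 - D| <= theta /\ `|w.1.2 + w.2 - D| <= theta].
have KjC : K \subset (~: [set j]%SET)%SET.
  by rewrite finset.subsetC finset.sub1set inE.
have K'jC : (K' :\ j)%SET \subset (~: [set j]%SET)%SET.
  by rewrite finset.setDE finset.subsetIr.
have mU : measurable_fun setT (U : g_sigma_algebraType (cylinders X (~: [set j])%SET) -> _).
  by apply: measurable_fun_pair; exact: measurable_set_sum_cylinders.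
have mU' : measurable_fun setT U.
  by apply: measurable_fun_pair; exact: measurable_set_sum.
have mX : measurable_fun setT (X j : g_sigma_algebraType (cylinders X (~: ~: [set j])%SET) -> R).
  by apply: measurable_fun_cylinders; rewrite finset.setCK finset.set11.
have mE : measurable E.
  apply: measurableI; rewrite -[X in measurable X]setTI.
    apply: (measurable_fun_le (f := fun w : (R * R) * R => `|w.1.1 - D|) (g := fun=> theta)) => //.
    apply: measurableT_comp => //; apply: measurable_funB => //.
    exact: measurableT_comp.
  apply: (measurable_fun_le (f := fun w : (R * R) * R => `|w.1.2 + w.2 - D|) (g := fun=> theta)) => //.
  apply: measurableT_comp => //; apply: measurable_funB => //.
  by apply: measurable_funD => //; exact: measurableT_comp.
have UX := indep_complementary_fun mU mX.
have -> : window K D theta `&`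
      window K' D theta = [set t | E (U t, X j t)].
  have eK' t : set_sum K' t = set_sum (K' :\ j)%SET t + X j t.
    by rewrite /set_sum (big_setD1 j jK')/= addrC.
  by apply/seteqP; split => t; rewrite /window /E /U /= eK'.
rewrite (indep_fubini mU' _ UX mE)//.
have mK : measurable (window K D theta).
  exact: cylinders_sigma_measurable (cylinders_window D theta (fintype.subxx K)).
rewrite -[X in (P X * _)%E]setIT -integral_indic// muleC -ge0_integralZl//; last exact/measurable_EFinP.
apply: ge0_le_integral => //.
- exact: measurable_section_probability.
- by apply/measurable_EFinP; exact: measurable_funM.
move=> s _; rewrite indicE /E /U /=.
have [sK|sK] := boolP (s \in window K D theta).
  rewrite mule1; apply: le_trans (Xjq (D - set_sum (K' :\ j)%SET s)).
  rewrite le_eqVlt; apply/orP; left; apply/eqP; congr (P _).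
  have eD t : set_sum (K' :\ j)%SET s + X j t - D = X j t - (D - set_sum (K' :\ j)%SET s).
    by ring.
  apply/seteqP; split => t /=; rewrite eD; first by case.
  by split => //; rewrite inE in sK.
rewrite mule0 (_ : [set t | _] = set0) ?measure0//.
by apply/seteqP; split => t //= -[sD _]; move: sK; rewrite notin_setE.
Qed.

End partial_sums.

(** * Random vectors: factorization over coordinates *)

Section random_vectors.
Context {d : measure_display} {T : measurableType d} {R : realType}.
Variable P : probability T R.
Variables (N m : nat) (Y : 'I_N -> {RV P >-> m.-tuple R}).

Definition coord (i : 'I_m) (j : 'I_N) : {RV P >-> R} := coordinate (Y j) i.

Definition coords (p : 'I_N * 'I_m) : {RV P >-> R} := coord p.2 p.1.

Lemma tnth_preimage_measurable (i : 'I_m) (B : set R) : measurable B ->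
  measurable [set y : m.-tuple R | B (tnth y i)].
Proof.
by move=> mB; have := @measurable_tnth _ R m i measurableT _ mB; rewrite setTI.
Qed.

Lemma coord_indep (i : 'I_m) : mutually_independent Y -> mutually_independent (coord i).
Proof.
move=> indY J A mA.
exact: (indY J (fun j => [set y : m.-tuple R | A j (tnth y i)])
  (fun j => tnth_preimage_measurable i (mA j))).
Qed.

Lemma coord_law (i : 'I_m) (j j' : 'I_N) : same_law (Y j) (Y j') ->
  same_law (coord i j) (coord i j').
Proof.
by move=> YY A mA; exact: (YY _ (tnth_preimage_measurable i mA)).
Qed.

(** Constraints on the entries of the vector [j] combine into one event [C j] on [Y j]; independence
    of the vectors separates the [C j], and independence of the entries splits each of them. *)
Lemma coords_indep : mutually_independent Y ->
  (forall j, mutually_independent (fun i => coordinate (Y j) i : {RV P >-> R})) ->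
  mutually_independent coords.
Proof.
move=> indY indC J A mA.
pose B p := if p \in J then A p else setT.
have mB p : measurable (B p) by rewrite /B; case: ifP.
pose C j := \big[setI/setT]_i [set y : m.-tuple R | B (j, i) (tnth y i)].
have mC j : measurable (C j).
  by apply: bigsetI_measurable => i _; exact: tnth_preimage_measurable.
have YC j : Y j @^-1` C j = \big[setI/setT]_i (coord i j @^-1` B (j, i)).
  rewrite /C; elim/big_rec2: _ => // i y1 y2 _ <-.
  by rewrite preimage_setI.
transitivity (P (\big[setI/setT]_j (Y j @^-1` C j))).
  congr (P _); apply/seteqP; split => t tA.
    elim/big_ind : _ => // j _; rewrite YC; elim/big_ind : _ => // i _.
    by rewrite /B /=; case: ifPn => // jJ; exact: tA.
  move=> -[j i] /= jJ.
  have : (\big[setI/setT]_j (Y j @^-1` C j)) t := tA.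
  rewrite (bigD1 j)// => -[+ _]; rewrite YC (bigD1 i)// => -[+ _].
  by rewrite /= /B jJ.
rewrite (mutually_independent_bigsetI indY)//.
transitivity (\prod_j \prod_i P (coord i j @^-1` B (j, i)))%E.
  apply: eq_bigr => j _; rewrite YC.
  exact: (mutually_independent_bigsetI (indC j) xpredT (fun i => mB (j, i))).
rewrite pair_bigA/= [RHS]big_mkcond/=; apply: eq_bigr => -[j i] _ /=.
by rewrite /B; case: ifPn => // _; rewrite preimage_setT probability_setT.
Qed.

Hypothesis indY : mutually_independent Y.
Hypothesis indC : forall j, mutually_independent (fun i => coordinate (Y j) i : {RV P >-> R}).

Definition event (K : {set 'I_N}) (D : 'I_m -> R) (theta : R) : set T :=
  \big[setI/setT]_i window (coord i) K (D i) theta.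

Lemma cylinders_coord (i : 'I_m) (K : {set 'I_N}) :
  cylinders (coord i) K `<=` cylinders coords [set p | p.2 == i]%SET.
Proof.
move=> _ [B mB ->].
exists (fun p => if p.1 \in K then B p.1 else setT); first by move=> p; case: ifP.
rewrite [RHS](partition_big (fun p => p.1) xpredT)//= [LHS]big_mkcond/=.
apply: eq_bigr => j _; rewrite (big_pred1 (j, i)).
  by case: ifP => // _; rewrite preimage_setT.
by move=> [j' i']; rewrite inE/= -pair_eqE/= andbC.
Qed.

(** [indep_blocks] for the grid of all scalar variables, cut into blocks by [p.2]: block [i] holds
    the [i]-th entries of all vectors. All later estimates thereby become one-dimensional. *)
Lemma prob_coord_inter (A : 'I_m -> set T) :
  (forall i, <<s cylinders (coord i) [set: 'I_N]%SET >> (A i)) ->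
  (P (\big[setI/setT]_i A i) = \prod_i P (A i))%E.
Proof.
move=> sA; apply: (indep_blocks (coords_indep indY indC) (g := fun p => p.2)) => i.
move: (A i) (sA i); apply: sub_sigma_algebra2; exact: cylinders_coord.
Qed.

Lemma prob_event K D theta :
  (P (event K D theta) = \prod_i P (window (coord i) K (D i) theta))%E.
Proof.
by apply: prob_coord_inter => i; exact: cylinders_window.
Qed.

Lemma prob_eventI K K' D theta :
  (P (event K D theta `&` event K' D theta) =
   \prod_i P (window (coord i) K (D i) theta `&` window (coord i) K' (D i) theta))%E.
Proof.
rewrite /event -big_split/=; apply: prob_coord_inter => i.
have m1 := cylinders_window (X := coord i) (D i) theta (finset.subsetT K).
have m2 := cylinders_window (X := coord i) (D i) theta (finset.subsetT K').
exact: (@measurableI _ (g_sigma_algebraType (cylinders (coord i) [set: 'I_N]%SET))).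
Qed.

End random_vectors.

(** * Second moment inequality *)

Section second_moment.
Context {d : measure_display} {T : measurableType d} {R : realType}.
Variable P : probability T R.

Lemma integral_sum_indic (J : Type) (s : seq J) (A : J -> set T) :
  (forall j, measurable (A j)) ->
  (\int[P]_t (\sum_(j <- s) \1_(A j) t)%:E = \sum_(j <- s) P (A j))%E.
Proof.
move=> mA; under eq_integral do rewrite -sumEFin.
rewrite ge0_integral_sum//.
  by apply: eq_bigr => j _; rewrite integral_indic// setIT.
by move=> j; apply/measurable_EFinP; exact: measurable_indic.
Qed.

(* Integrating [2 c z - c^2 z^2 <= 1] at the number [z] of events that occur, an
   expression which vanishes when none does. *)
Lemma second_moment (J : Type) (s : seq J) (A : J -> set T) (c : R) :
  (forall j, measurable (A j)) -> 0 <= c ->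
  ((2 * c)%:E * \sum_(j <- s) P (A j) <=
   P (\big[setU/set0]_(j <- s) A j) +
   (c ^+ 2)%:E * \sum_(j <- s) \sum_(j' <- s) P (A j `&` A j'))%E.
Proof.
move=> mA c0.
pose U := \big[setU/set0]_(j <- s) A j.
have mU : measurable U by apply: bigsetU_measurable.
pose Z t : R := \sum_(j <- s) \1_(A j) t.
have Z0 t : 0 <= Z t by apply: sumr_ge0.
have ZZ t : Z t * Z t = \sum_(p <- [seq (j, j') | j <- s, j' <- s]) \1_(A p.1 `&` A p.2) t.
  rewrite big_allpairs_dep/= /Z mulr_suml; apply: eq_bigr => j _.
  by rewrite mulr_sumr; apply: eq_bigr => j' _; rewrite indicI.
have mZ : measurable_fun setT Z.
  by apply: measurable_sum => j; exact: measurable_indic.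
have ZU t : ~ U t -> Z t = 0.
  move=> Ut; rewrite /Z; move: Ut; rewrite /U; elim: (s) => [|x s' IH].
    by rewrite !big_nil.
  rewrite !big_cons => Ut; rewrite IH; last by move=> Us'; apply: Ut; right.
  by rewrite addr0 indicE memNset// => Ax; apply: Ut; left.
have Zint : (\int[P]_t (Z t)%:E = \sum_(j <- s) P (A j))%E by exact: integral_sum_indic.
have ZZint : (\int[P]_t (Z t * Z t)%:E = \sum_(j <- s) \sum_(j' <- s) P (A j `&` A j'))%E.
  under eq_integral do rewrite ZZ.
  rewrite integral_sum_indic; first by rewrite big_allpairs_dep.
  by move=> -[j j']; exact: measurableI.
have mEZ : measurable_fun setT (fun t => (Z t)%:E) by exact/measurable_EFinP.
have mEZZ : measurable_fun setT (fun t => (Z t * Z t)%:E).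
  by apply/measurable_EFinP; exact: measurable_funM.
have c20 : (0 <= (2 * c)%:E)%E by rewrite lee_fin mulr_ge0.
have cc0 : (0 <= (c ^+ 2)%:E)%E by rewrite lee_fin sqr_ge0.
have EZ0 t : setT t -> (0 <= (Z t)%:E)%E by rewrite lee_fin.
have EZZ0 t : setT t -> (0 <= (Z t * Z t)%:E)%E by rewrite lee_fin mulr_ge0.
rewrite -Zint -ZZint -!ge0_integralZl//.
rewrite -/U -[X in (P X + _)%E]setIT -integral_indic// -ge0_integralD//.
- apply: ge0_le_integral => //.
  + by move=> t _; rewrite -EFinM lee_fin !mulr_ge0.
  + by apply: emeasurable_funM => //; exact/measurable_EFinP.
  + apply: emeasurable_funD; first by apply/measurable_EFinP; exact: measurable_indic.
    by apply: emeasurable_funM => //; apply/measurable_EFinP; exact: measurable_funM.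
  move=> t _; rewrite -!EFinM -EFinD lee_fin indicE.
  have [Ut|Ut] := pselect (U t).
    by rewrite mem_set//=; have := sqr_ge0 (1 - c * Z t); nra.
  by rewrite ZU// !mulr0 addr0.
- by apply/measurable_EFinP; exact: measurable_indic.
- by move=> t _; rewrite mule_ge0// lee_fin mulr_ge0.
- exact: emeasurable_funM.
Qed.

End second_moment.

(** * Numerical estimates *)

Lemma pi_le4 (R : realType) : pi <= 4 :> R.
Proof. by have := pihalf_lt2 R; lra. Qed.

Section numerics.
Variables (R : realType) (k m a k0 : nat) (theta gamma M : R).
(** The fourth root of [m]: the exponents [1/2], [3/2] and [7/4] become the integer powers 2, 6 and
    7 of [u]. *)
Local Notation u := (Num.sqrt (Num.sqrt m%:R) : R).
Local Notation C := ('C(a * k, k)%:R : R).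
Local Notation r := (2 * theta / Num.sqrt (2 * pi * k%:R)).
Hypotheses (k_gt0 : (0 < k)%N) (m_gt0 : (0 < m)%N).
Hypothesis aE : a%:Z = Num.ceil (2 * Num.sqrt (m%:R : R)).
Hypothesis theta_gt0 : 0 < theta.
Hypothesis rC : r ^+ m * C = 1.
Hypotheses (gamma_ge0 : 0 <= gamma) (M_gt0 : 0 < M).
Hypothesis k_ge_k0 : (4 * Num.sqrt m%:R + 2) * k0%:R <= k%:R :> R.
Hypothesis k_ge_M : 144 * m%:R `^ (3 / 2) * (ln M + 3) <= k%:R.
Hypothesis k_ge_gamma : 150 * 10 ^+ 3 * (gamma + 1) * m%:R `^ (7 / 4) <= k%:R.

Lemma sqr_root4 : u ^+ 2 = Num.sqrt m%:R.
Proof. by rewrite sqr_sqrtr// sqrtr_ge0. Qed.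

Lemma exp4_root4 : u ^+ 4 = m%:R.
Proof. by rewrite (exprM _ 2 2) sqr_root4 sqr_sqrtr. Qed.

Lemma root4_ge1 : 1 <= u.
Proof.
have sqrt_ge1 (x : R) : 1 <= x -> 1 <= Num.sqrt x by rewrite -{2}(sqrtr1 R) => /ler_wsqrtr.
by apply: (sqrt_ge1); apply: (sqrt_ge1); rewrite ler1n.
Qed.

Lemma powR_root4 (p : nat) (q : R) : 4 * q = p%:R -> m%:R `^ q = u ^+ p.
Proof.
move=> qE; rewrite -[X in X `^ _]exp4_root4 -!powR_mulrn ?sqrtr_ge0// -powRrM.
by rewrite -qE.
Qed.

Lemma k_ge_u7 : 150 * 10 ^+ 3 * (gamma + 1) * u ^+ 7 <= k%:R.
Proof.
by rewrite -(@powR_root4 7 (7 / 4))//; field.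
Qed.

Lemma k_ge_lnM : 144 * u ^+ 6 * (ln M + 3) <= k%:R.
Proof. by rewrite -(@powR_root4 6 (3 / 2))//; field. Qed.

Lemma a_ge : 2 * u ^+ 2 <= a%:R.
Proof.
rewrite sqr_root4; have := ceil_ge (2 * Num.sqrt (m%:R : R)); by rewrite -aE.
Qed.

Lemma a_lt : a%:R < 2 * u ^+ 2 + 1.
Proof.
rewrite sqr_root4; have := ceilB1_lt (2 * Num.sqrt (m%:R : R)); rewrite -aE.
by rewrite intrD/= => h; lra.
Qed.

Lemma u2_ge1 : 1 <= u ^+ 2.
Proof. by have := root4_ge1; nra. Qed.

Lemma a_le : a%:R <= 3 * u ^+ 2.
Proof. have := a_lt; have := u2_ge1; lra. Qed.

Lemma a_ge2 : (2 <= a)%N.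
Proof. rewrite -(ler_nat R); have := a_ge; have := u2_ge1; lra. Qed.

Lemma k_gt0R : 0 < k%:R :> R. Proof. by rewrite ltr0n. Qed.

Lemma ln_le_subr1 (x : R) : 0 < x -> ln x <= x - 1.
Proof.
move=> x0; have := @le_ln1Dx R (x - 1); rewrite [1 + _]addrC subrK; apply.
by rewrite ltrBrDl addrN.
Qed.

(* [150 * 10 ^+ 3] is kept as a product: the literal would be a unary numeral. *)
Lemma ln_big_constant_le : ln (8 * (150 * 10 ^+ 3) : R) <= 21.
Proof.
have c0 : 0 < 8 * (150 * 10 ^+ 3) :> R by lra.
rewrite -(expRK 21) ler_ln ?posrE ?expR_gt0//.
have e2 : 2 <= expR 1 :> R by have := expR_ge1Dx (1 : R); lra.
have -> : 21 = 21%:R * 1 :> R by lra.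
rewrite expRM_natl; apply: (@le_trans _ _ (2 ^+ 21)).
  lra.
by rewrite lerXn2r ?nnegrE ?expR_ge0.
Qed.

(** Needed to absorb powers [k^(m/2)]. With [v = c u^7] the least size of [k], splitting
    [8 k = (8 c) u^7 (k / v)] and using [ln x <= x - 1] on the last two factors leaves terms in
    [u^7] and [k / v] that are small fractions of [k]. *)
Lemma ln8k_le : 240 * u ^+ 6 * ln (8 * k%:R) <= k%:R.
Proof.
have u1 := root4_ge1; have u0 : 0 < u by lra.
have kR := k_gt0R; have kg := k_ge_u7; have lc := ln_big_constant_le.
have c_ge : 150 * 1000 <= 150 * 10 ^+ 3 :> R by lra.
have gc := gamma_ge0.
move: (150 * 10 ^+ 3) kg lc c_ge => c kg lc c_ge.
have c0 : 0 < c by lra.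
set v := c * u ^+ 7.
have v0 : 0 < v by rewrite /v mulr_gt0// exprn_gt0//; lra.
have kv : v <= k%:R.
  apply: le_trans kg; rewrite ler_wpM2r ?exprn_ge0 ?(ltW u0)//.
  by rewrite ler_peMr ?(ltW c0)//; lra.
have ln1 : ln (8 * k%:R) <= 13 + 7 * u + k%:R / v.
  have -> : 8 * k%:R = (8 * c * u ^+ 7) * (k%:R / v).
    by rewrite /v; field; rewrite !gt_eqF.
  have u7 : 0 < u ^+ 7 by rewrite exprn_gt0.
  have c8 : 0 < 8 * c by rewrite mulr_gt0.
  have kv0 : 0 < k%:R / v by rewrite divr_gt0.
  rewrite lnM ?posrE// ?mulr_gt0//.
  rewrite lnM ?posrE// lnXn//.
  have h1 := ln_le_subr1 kv0; have h2 := ln_le_subr1 u0.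
  lra.
have u6 : 0 < u ^+ 6 by rewrite exprn_gt0.
have h4 : k%:R / v * (240 * u ^+ 6) <= k%:R * (1 / 600).
  rewrite mulrAC ler_pdivrMr// /v.
  have : u ^+ 6 <= u ^+ 7 by apply: ler_weXn2l.
  move: (u ^+ 6) (u ^+ 7) u6 => w w7 w0 ww.
  have : 1000 * 150 * w7 <= c * w7 by rewrite ler_wpM2r//; lra.
  move=> h; have := ler_wpM2l (ltW kR) h; have := ler_wpM2l (ltW kR) ww.
  have : 0 <= k%:R * w by rewrite mulr_ge0// ltW.
  lra.
have h5 : (13 + 7 * u) * (240 * u ^+ 6) <= 4800 * u ^+ 7.
  rewrite [u ^+ 7]exprS; move: (u ^+ 6) u6 => w w0; nra.
have h6 : 0 <= 240 * u ^+ 6 := mulr_ge0 (ler0n _ _) (ltW u6).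
have h7 : 1000 * 150 * u ^+ 7 <= v by apply: ler_wpM2r; [by rewrite exprn_ge0 // ltW | lra].
have := ler_wpM2r h6 ln1; lra.
Qed.

Lemma bin_ge_exp2 : 2 ^+ k <= C.
Proof.
rewrite -natrX ler_nat.
have := @bin_cross_leq k (a * k) k; rewrite leq_pmull ?(leq_trans _ a_ge2)//.
move=> /(_ isT); rewrite binn mul1n expnMn leq_pmul2r ?expn_gt0 ?k_gt0//.
by apply: leq_trans; rewrite leq_exp2r// a_ge2.
Qed.

Lemma r_gt0 : 0 < r.
Proof.
by rewrite divr_gt0 ?mulr_gt0// sqrtr_gt0 !mulr_gt0 ?pi_gt0// ltr0n.
Qed.

Lemma m_ln8k_le : m%:R * ln (8 * k%:R) <= k%:R / (240 * u ^+ 2).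
Proof.
have u1 := root4_ge1; have u0 : 0 < u by lra.
have u2 : 0 < u ^+ 2 by rewrite exprn_gt0.
have v0 : 0 < 240 * u ^+ 2 by lra.
rewrite ler_pdivlMr//; have := ln8k_le.
rewrite (exprD u 4 2) exp4_root4; lra.
Qed.

(** The binomial coefficient is at least [2^k], which exceeds [exp (k / 2) >= (8 k)^m]; hence
    [r <= 1 / (8 k)]. The window is then so short that the variation of [phi] over it is no worse
    than an error [1 / n]. *)
Lemma theta_sqrt_le : theta * Num.sqrt k%:R <= 1.
Proof.
have kR := k_gt0R; have r0 := r_gt0.
have sp0 : 0 < Num.sqrt (2 * pi * k%:R) :> R.
  by rewrite sqrtr_gt0 !mulr_gt0// pi_gt0.
have r_le : r <= (8 * k%:R)^-1.
  rewrite leNgt; apply/negP => r_gt.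
  have : (8 * k%:R)^-1 ^+ m < r ^+ m.
    by rewrite ltrXn2r ?gtn_eqF// ?nnegrE ?invr_ge0 ?mulr_ge0 ?(ltW kR) ?(ltW r0).
  rewrite exprVn => h.
  have C0 : 0 < C by apply: lt_le_trans bin_ge_exp2; rewrite exprn_gt0.
  have : C < (8 * k%:R) ^+ m.
    have e0 : 0 < (8 * k%:R) ^+ m :> R by rewrite exprn_gt0// mulr_gt0.
    by move: h; rewrite -(ltr_pM2r C0) rC ltr_pdivrMl// mulr1.
  apply/negP; rewrite -leNgt; apply: le_trans bin_ge_exp2.
  have e8 : 8 * k%:R = expR (ln (8 * k%:R)) :> R by rewrite lnK// posrE mulr_gt0.
  rewrite e8 -expRM_natl; apply: (@le_trans _ _ (expR (k%:R * (1 / 2)))).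
    rewrite ler_expR; apply: le_trans m_ln8k_le _.
    have u20 : 0 < 240 * u ^+ 2 by have := u2_ge1; lra.
    rewrite ler_pdivrMr//; have := u2_ge1; move: (u ^+ 2) => w w1; nra.
  rewrite expRM_natl lerXn2r ?nnegrE ?expR_ge0//.
  have : 1 / 2 <= expR (- (1 / 2) : R) by apply: le_trans (expR_ge1Dx _); lra.
  rewrite expRN -[X in X <= _]invrK lef_pV2 ?posrE ?expR_gt0 ?invr_gt0//.
  by rewrite mul1r invrK.
have thE : theta = r * Num.sqrt (2 * pi * k%:R) / 2 by field; rewrite gt_eqF.
move: r0 r_le thE; move: r => q r0 r_le ->.
rewrite sqrtrM ?mulr_ge0 ?pi_ge0//.
have -> : q * (Num.sqrt (2 * pi) * Num.sqrt k%:R) / 2 * Num.sqrt k%:R =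
   q * Num.sqrt (2 * pi) * (Num.sqrt k%:R ^+ 2) / 2 by ring.
rewrite sqr_sqrtr ?ler0n//.
have s3 : Num.sqrt (2 * pi) <= 3 :> R.
  have /ler_wsqrtr : 2 * pi <= 3 ^+ 2 :> R by have := pi_le4 R; lra.
  by rewrite sqrtr_sqr ger0_norm.
have : q * k%:R <= 1 / 8.
  have := ler_wpM2r (ltW kR) r_le; rewrite invfM -mulrA mulVf ?gt_eqF// mulr1.
  by rewrite mul1r.
have s0 : 0 <= Num.sqrt (2 * pi) :> R by rewrite sqrtr_ge0.
move: (Num.sqrt (2 * pi)) s3 s0 => w w3 w0.
move=> h.
have : 0 <= q * k%:R by rewrite mulr_ge0// ltW.
have -> : q * w * k%:R / 2 = (q * k%:R) * w / 2 by ring.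
move: (q * k%:R) h => z z1 z0; nra.
Qed.

Lemma gamma1_div_k_le : (gamma + 1) / k%:R * u ^+ 7 <= 1 / 2000.
Proof.
have w0 : 0 <= u ^+ 7 by rewrite exprn_ge0// sqrtr_ge0.
have gw : 0 <= gamma * u ^+ 7 by rewrite mulr_ge0.
rewrite mulrAC ler_pdivrMr ?k_gt0R//.
by have := k_ge_u7; lra.
Qed.

(** The coefficient [4 sqrt m + 2] bounds [2 a] because [a < 2 sqrt m + 1]. An overlap of at least
    [k / (2 a)] then has at least [k0] vectors. *)
Lemma two_a_k0_le : (2 * a * k0 <= k)%N.
Proof.
rewrite -(ler_nat R) !natrM; apply: le_trans k_ge_k0; rewrite ler_wpM2r//.
by rewrite -sqr_root4; have := a_lt; lra.
Qed.

(** Writing [2 theta M = r (w M)] with [w = sqrt (2 pi k)] cancels the binomial coefficient. The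
    Chernoff exponent is at least [k / (48 u^2)], while [w^m] and [M^m] use up [k / (480 u^2)] and
    [k / (144 u^2)]. The leading 2 is for the two tails. *)
Lemma tail_le : 2 * (C * expR (- (k%:R / (16 * a%:R)))) * (2 * theta * M) ^+ m <= 1.
Proof.
have u1 := root4_ge1; have u0 : 0 < u by lra.
have u2 : 0 < u ^+ 2 by rewrite exprn_gt0.
have kR := k_gt0R.
have a0 : 0 < a%:R :> R by rewrite ltr0n (leq_trans _ a_ge2).
pose w : R := Num.sqrt (2 * pi * k%:R).
have w0 : 0 < w by rewrite sqrtr_gt0 !mulr_gt0// pi_gt0.
have -> : 2 * theta * M = r * (w * M) by rewrite -/w mulrA divfK// gt_eqF.
rewrite exprMn [X in X <= _](_ : _ = r ^+ m * C *
  (2 * expR (- (k%:R / (16 * a%:R))) * (w * M) ^+ m)); last by ring.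
rewrite rC mul1r exprMn.
have w_le : w ^+ m <= expR (k%:R / (480 * u ^+ 2)).
  have ws : w <= expR (ln (8 * k%:R) / 2).
    rewrite -(@ler_pXn2r _ 2)// ?nnegrE ?expR_ge0 ?(ltW w0)//.
    rewrite sqr_sqrtr ?mulr_ge0 ?pi_ge0// -expRM_natl.
    have -> : 2%:R * (ln (8 * k%:R) / 2) = ln (8 * k%:R) :> R by field.
    rewrite lnK ?posrE ?mulr_gt0// ler_wpM2r ?(ltW kR)//; have := pi_le4 R; lra.
  apply: (@le_trans _ _ (expR (ln (8 * k%:R) / 2) ^+ m)).
    by rewrite lerXn2r ?nnegrE ?expR_ge0// ltW.
  rewrite -expRM_natl ler_expR mulrA.
  have -> : k%:R / (480 * u ^+ 2) = k%:R / (240 * u ^+ 2) / 2 by field; rewrite gt_eqF.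
  by rewrite ler_wpM2r// m_ln8k_le.
(* The summand 3 of [ln M + 3] yields [exp (-3 m) <= 1/4], which pays for the factor 2. *)
have M_le : M ^+ m <= expR (k%:R / (144 * u ^+ 2) - 3 * m%:R).
  rewrite -{1}(lnK (x := M)) ?posrE// -expRM_natl ler_expR.
  have := k_ge_lnM; rewrite (exprD u 4 2) exp4_root4 => h.
  have u144 : 0 < 144 * u ^+ 2 by rewrite pmulr_rgt0 ?ltr0n.
  rewrite lerBrDr ler_pdivlMr//; lra.
have e_le : expR (- (k%:R / (16 * a%:R))) <= expR (- (k%:R / (48 * u ^+ 2))).
  rewrite ler_expR lerN2 ler_pM2l// lef_pV2 ?posrE ?mulr_gt0//.
  by have := a_le; lra.
have e3 : 4 <= expR 3 :> R by apply: le_trans (expR_ge1Dx _); lra.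
have fin : expR (- (k%:R / (48 * u ^+ 2))) * (expR (k%:R / (480 * u ^+ 2)) *
    expR (k%:R / (144 * u ^+ 2) - 3 * m%:R)) <= (expR 3)^-1.
  rewrite -!expRD -expRN ler_expR.
  have m1 : 1 <= m%:R :> R by rewrite ler1n.
  have z0 : 0 <= k%:R / u ^+ 2 by rewrite divr_ge0// ltW.
  have zE (b : R) : k%:R / (b * u ^+ 2) = (k%:R / u ^+ 2) / b.
    by rewrite invfM mulrCA mulrC.
  rewrite !zE; move: (k%:R / u ^+ 2) z0 => z z0.
  lra.
have ei : (expR 3)^-1 <= 1 / 4 :> R.
  by rewrite -[leRHS]invrK lef_pV2 ?posrE ?expR_gt0 ?invr_gt0// mul1r invrK.
rewrite -mulrA; apply: (@le_trans _ _ (2 * (1 / 4))); last by lra.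
rewrite ler_wpM2l//; apply: le_trans ei; apply: le_trans fin.
rewrite ler_pM ?expR_ge0 ?mulr_ge0 ?exprn_ge0 ?(ltW w0) ?(ltW M_gt0)//.
by rewrite ler_pM ?exprn_ge0 ?(ltW w0) ?(ltW M_gt0).
Qed.

End numerics.

(** * Per-coordinate inequalities for typical overlaps and for the mean *)

Section middle_range.
Variables (R : realType) (k m a : nat) (theta gamma u : R).
Local Notation r := (2 * theta / Num.sqrt (2 * pi * k%:R)).
Hypotheses (k_gt0 : (0 < k)%N) (m_gt0 : (0 < m)%N).
Hypotheses (u_ge1 : 1 <= u) (u4E : u ^+ 4 = m%:R).
Hypotheses (a_gt1 : (2 <= a)%N) (a_lb : 2 * u ^+ 2 <= a%:R) (a_ub : a%:R <= 3 * u ^+ 2).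
Hypotheses (theta_gt0 : 0 < theta) (gamma_ge0 : 0 <= gamma).
Hypothesis theta_k : theta * Num.sqrt k%:R <= 1.
Hypothesis gamma_k : (gamma + 1) / k%:R * u ^+ 7 <= 1 / 2000.

Let k_gt0R : 0 < k%:R :> R. Proof. by rewrite ltr0n. Qed.

Let u2_ge1 : 1 <= u ^+ 2. Proof. by have := u_ge1; nra. Qed.

(** Since [n (n + 2 s) = k^2 - s^2], the left side is [n (1 - (s / k)^2)^(-1/2)]. From
    [s <= 3 k / (2 a)] and [a >= 2 sqrt m] comes [(s / k)^2 <= x] with [x = 9 / (16 m)]. *)
Lemma middle_sqrt_le (s n : nat) : (s + n)%N = k -> (2 * a * s <= 3 * k)%N ->
  k%:R * Num.sqrt (n%:R / (n%:R + 2 * s%:R)) <= (1 + 9 / (16 * m%:R)) * n%:R :> R.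
Proof.
move=> snk ask.
have kR := k_gt0R; have m0 : 0 < m%:R :> R by rewrite ltr0n.
have kE : k%:R = s%:R + n%:R :> R by rewrite -natrD snk.
have as3 : 2 * a%:R * s%:R <= 3 * k%:R :> R by rewrite -!natrM ler_nat.
have s0 : 0 <= s%:R :> R by []; have n0 : 0 <= n%:R :> R by [].
have u2 : 0 < u ^+ 2 by have := u2_ge1; lra.
have us : 4 * u ^+ 2 * s%:R <= 3 * k%:R.
  by apply: le_trans as3; rewrite ler_wpM2r//; have := a_lb; lra.
have ms : 16 * m%:R * s%:R ^+ 2 <= 9 * k%:R ^+ 2 :> R.
  rewrite -u4E (exprM _ 2 2).
  have h0 : 0 <= 4 * u ^+ 2 * s%:R.
    apply: mulr_ge0 => //; apply: mulr_ge0 => //; exact: ltW.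
  by have := ler_pM h0 h0 us us; lra.
set x := 9 / (16 * m%:R) : R.
have xm : x * (16 * m%:R) = 9 by rewrite /x divfK// gt_eqF// mulr_gt0.
have x0 : 0 < x by rewrite /x divr_gt0// mulr_gt0.
have m1 : 1 <= m%:R :> R by rewrite ler1n.
have x1 : x <= 9 / 16.
  have : x * 16 <= x * (16 * m%:R) by rewrite ler_wpM2l ?(ltW x0)//; lra.
  lra.
have xs : s%:R ^+ 2 <= x * k%:R ^+ 2.
  have : 0 < 16 * m%:R :> R by rewrite mulr_gt0.
  by move=> h; rewrite /x mulrAC ler_pdivlMr//; lra.
rewrite -[k%:R]ger0_norm ?(ltW kR)// -sqrtr_sqr -sqrtrM ?sqr_ge0//.
rewrite -[leRHS]ger0_norm ?mulr_ge0 ?addr_ge0 ?(ltW x0)//.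
rewrite -[leRHS]sqrtr_sqr ler_wsqrtr//.
have ns0 : 0 < n%:R + 2 * s%:R :> R by lra.
rewrite mulrA ler_pdivrMr//.
rewrite [leRHS](_ : _ = (1 + x) ^+ 2 * (n%:R * (n%:R + 2 * s%:R)) * n%:R); last by ring.
rewrite ler_wpM2r//.
have xk : (1 - x) * k%:R ^+ 2 <= n%:R * (n%:R + 2 * s%:R).
  by move: xs; rewrite kE; lra.
have h0 : 0 <= (1 + x) ^+ 2 by rewrite sqr_ge0.
have := ler_wpM2l h0 xk; apply: le_trans.
(* The inequality [(1 + x)^2 (1 - x) >= 1] holds because [0 <= x <= 9/16]. *)
rewrite mulrA ler_peMl ?sqr_ge0//; nra.
Qed.

(** Origin of [gamma + 1]: the variation of [phi] over the window adds at most [1 / n] to the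
    density error [gamma / n]. *)
Lemma window_error_le (n : nat) : (0 < n)%N -> (n <= k)%N -> 
  gamma / n%:R + theta / Num.sqrt n%:R <= (gamma + 1) / n%:R.
Proof.
move=> n0 nk.
have nR : 0 < n%:R :> R by rewrite ltr0n.
have sn : 0 < Num.sqrt n%:R :> R by rewrite sqrtr_gt0.
rewrite mulrDl lerD2l mul1r.
have -> : n%:R^-1 = (Num.sqrt n%:R)^-1 * (Num.sqrt n%:R)^-1 :> R.
  by rewrite -invfM -expr2 sqr_sqrtr// ltW.
rewrite ler_pM2r ?invr_gt0// -[leRHS]mul1r ler_pdivlMr//.
by apply: le_trans theta_k; rewrite ler_wpM2l ?(ltW theta_gt0)// ler_wsqrtr// ler_nat.
Qed.

(** Relative to [r^2], the main term exceeds 1 by at most [9 / (16 m)] and the errors stay below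
    [2 / (5 m)], so [1 / m] covers both. The first error is of order [u^3 (gamma + 1) / k], and
    [u^3 m = u^7] is the power in [gamma_k]. *)
Lemma middle_le (s n : nat) : (s + n)%N = k -> (k <= 2 * a * s)%N ->
  (2 * a * s <= 3 * k)%N ->
  (2 * theta) ^+ 2 / n%:R *
    (Num.sqrt (n%:R / (n%:R + 2 * s%:R)) / (2 * pi) +
     gamma / s%:R / 2 * Num.sqrt (n%:R / s%:R) +
     2 * (gamma / n%:R + theta / Num.sqrt n%:R)) <= r ^+ 2 * (1 + 1 / m%:R).
Proof.
move=> snk kas ask.
have kR := k_gt0R; have m0 : 0 < m%:R :> R by rewrite ltr0n.
have kE : k%:R = s%:R + n%:R :> R by rewrite -natrD snk.
have as3 : 2 * a%:R * s%:R <= 3 * k%:R :> R by rewrite -!natrM ler_nat.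
have ask' : k%:R <= 2 * a%:R * s%:R :> R by rewrite -!natrM ler_nat.
have a2 : 2 <= a%:R :> R by rewrite ler_nat a_gt1.
have s0 : 0 <= s%:R :> R by [].
have nk4 : k%:R <= 4 * n%:R :> R.
  have : 4 * s%:R <= 2 * a%:R * s%:R :> R by rewrite ler_wpM2r//; lra.
  lra.
have nR : 0 < n%:R :> R by lra.
have sR : 0 < s%:R :> R.
  by rewrite lt_neqAle eq_sym s0 andbT; apply: contraTneq ask' => ->; rewrite mulr0 -ltNge.
have n_gt0 : (0 < n)%N by rewrite -(ltr0n R).
have nk : (n <= k)%N by rewrite -snk leq_addl.
have u1 := u_ge1; have u0 : 0 < u by lra.
have u2 := u2_ge1.
have pi0 : 0 < pi :> R := pi_gt0 R.
have p0 : 0 < 2 * pi :> R by rewrite mulr_gt0// pi_gt0.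
have pk : 0 < 2 * pi * k%:R :> R by rewrite mulr_gt0.
have p8 : 2 * pi <= 8 :> R by have := pi_le4 R; lra.
pose e := (gamma + 1) / k%:R.
have e0 : 0 <= e by rewrite divr_ge0 ?addr_ge0 ?(ltW kR).
have eu : e * u ^+ 7 <= 1 / 2000 := gamma_k.
have X_le := middle_sqrt_le snk ask.
have w_le : gamma / n%:R + theta / Num.sqrt n%:R <= 4 * e.
  apply: le_trans (window_error_le n_gt0 nk) _.
  rewrite /e mulrCA ler_wpM2l ?addr_ge0// ler_pdivlMr// mulrC ler_pdivrMr//.
have a3 := a_ub.
have gs_le : gamma / s%:R <= 6 * u ^+ 2 * e.
  rewrite ler_pdivrMr// /e.
  rewrite [leRHS](_ : _ = (gamma + 1) * (6 * u ^+ 2 * s%:R / k%:R)); last by ring.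
  have : 1 <= 6 * u ^+ 2 * s%:R / k%:R.
    rewrite ler_pdivlMr// mul1r; apply: le_trans ask' _.
    by rewrite ler_wpM2r//; lra.
  move: (6 * u ^+ 2 * s%:R / k%:R) => z z1; have := gamma_ge0; nra.
have sq_le : Num.sqrt (n%:R / s%:R) <= 3 * u.
  have u30 : 0 <= 3 * u by rewrite mulr_ge0 ?(ltW u0).
  rewrite -[leRHS]ger0_norm// -[leRHS]sqrtr_sqr ler_wsqrtr// ler_pdivrMr//.
  apply: (@le_trans _ _ k%:R); first by rewrite kE; lra.
  apply: le_trans ask' _; rewrite ler_wpM2r//.
  rewrite exprMn; have -> : 3 ^+ 2 = 9 :> R by ring.
  lra.
have -> : r ^+ 2 * (1 + 1 / m%:R) = (2 * theta) ^+ 2 / n%:R *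
    (n%:R / (2 * pi * k%:R) * (1 + 1 / m%:R)).
  rewrite expr_div_n sqr_sqrtr ?(ltW pk)//.
  by move: (pi : R) pi0 => p p1; field; rewrite !gt_eqF.
rewrite ler_wpM2l ?divr_ge0 ?sqr_ge0 ?(ltW nR)//.
have -> : n%:R / (2 * pi * k%:R) * (1 + 1 / m%:R) = n%:R * (1 + 1 / m%:R) / (2 * pi * k%:R) :> R.
  by rewrite mulrAC.
rewrite ler_pdivlMr//.
set X := Num.sqrt (n%:R / (n%:R + 2 * s%:R)) in X_le *.
set A := gamma / s%:R / 2 * _; set B := 2 * (_ + _).
have -> : (X / (2 * pi) + A + B) * (2 * pi * k%:R) = k%:R * X + 2 * pi * k%:R * (A + B).
  by move: (pi : R) pi0 => p p1; field; rewrite !gt_eqF.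
have A0 : 0 <= A by rewrite !mulr_ge0 ?invr_ge0 ?(ltW sR) ?sqrtr_ge0.
have A_le : A <= 9 * (u ^+ 3 * e).
  have : A <= 6 * u ^+ 2 * e / 2 * (3 * u).
    rewrite /A ler_pM ?sqrtr_ge0 ?divr_ge0 ?(ltW sR)//.
    by rewrite ler_wpM2r ?invr_ge0.
  rewrite [u ^+ 3]exprSr; lra.
have B_le : B <= 8 * e by rewrite /B; lra.
have B0 : 0 <= B.
  by rewrite /B mulr_ge0 ?addr_ge0 ?divr_ge0 ?(ltW nR) ?sqrtr_ge0 ?(ltW theta_gt0).
have step1 : 2 * pi * k%:R * (A + B) <= 32 * n%:R * (A + B).
  rewrite ler_wpM2r ?addr_ge0//; apply: (@le_trans _ _ (8 * k%:R)).
    by rewrite ler_wpM2r// ltW.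
  lra.
have m4 : m%:R = u ^+ 4 by rewrite u4E.
have step2 : 32 * (A + B) <= (2 / 5) / m%:R.
  rewrite ler_pdivlMr//.
  have e3 : u ^+ 3 * e * m%:R <= 1 / 2000.
    by rewrite m4 mulrAC -exprD mulrC.
  have e4 : e * m%:R <= 1 / 2000.
    rewrite m4; apply: le_trans eu; rewrite ler_wpM2l//; exact: ler_weXn2l.
  have : (A + B) * m%:R <= (9 * (u ^+ 3 * e) + 8 * e) * m%:R.
    by rewrite ler_wpM2r ?(ltW m0)//; lra.
  lra.
have := ler_wpM2l (ltW nR) step2.
move: X_le step1; have -> : 9 / (16 * m%:R) = 9 / 16 / m%:R :> R by field; rewrite gt_eqF.
rewrite mul1r; have : 0 <= n%:R / m%:R :> R by rewrite divr_ge0 ?(ltW m0) ?(ltW nR).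
rewrite -[_ / m%:R]mulrC; lra.
Qed.

Lemma bernoulli_ineq (x : R) (n : nat) : 0 <= x <= 1 -> 1 - n%:R * x <= (1 - x) ^+ n.
Proof.
move=> /andP[x0 x1]; elim: n => [|n IH]; first by rewrite expr0 mul0r subr0.
rewrite exprS -natr1.
have x1' : 0 <= 1 - x by rewrite subr_ge0.
have := ler_wpM2l x1' IH; have : 0 <= n%:R * x * x by rewrite !mulr_ge0.
lra.
Qed.

(** As [y^2 <= k], the exponential is at least [1/2], so the additive error becomes a relative one,
    [1 / (300 m)], which survives a product of [m] factors. *)
Lemma gauss_window_lower (y : R) : y ^+ 2 <= k%:R ->
  r * (expR (- (y ^+ 2 / (2 * k%:R))) * (1 - 1 / (300 * m%:R))) <=
  2 * theta / Num.sqrt k%:R *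
    (normal_pdf 0 1 (y / Num.sqrt k%:R) - (gamma / k%:R + theta / Num.sqrt k%:R)).
Proof.
move=> yk.
have kR := k_gt0R; have sk : 0 < Num.sqrt k%:R :> R by rewrite sqrtr_gt0.
have m0 : 0 < m%:R :> R by rewrite ltr0n.
pose e := (gamma + 1) / k%:R.
have em : e * m%:R <= 1 / 2000.
  apply: le_trans gamma_k; rewrite -u4E ler_wpM2l ?divr_ge0 ?addr_ge0 ?(ltW kR)//.
  exact: ler_weXn2l.
have err : gamma / k%:R + theta / Num.sqrt k%:R <= e by exact: window_error_le.
rewrite std_normal_pdfE expr_div_n sqr_sqrtr ?(ltW kR)//.
have -> : y ^+ 2 / k%:R / 2 = y ^+ 2 / (2 * k%:R) by field; rewrite gt_eqF.
set E := expR _.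
have E_ge : 1 / 2 <= E.
  apply: le_trans (expR_ge1Dx _).
  have : y ^+ 2 / (2 * k%:R) <= 1 / 2 by rewrite ler_pdivrMr ?mulr_gt0//; lra.
  lra.
have q0 := sqrt2pi_gt0 (R := R).
have q3 : Num.sqrt (2 * pi) <= 3 :> R.
  have /ler_wsqrtr : 2 * pi <= 3 ^+ 2 :> R by have := pi_le4 R; lra.
  by rewrite sqrtr_sqr ger0_norm.
have rE : r = 2 * theta / Num.sqrt k%:R / Num.sqrt (2 * pi).
  rewrite sqrtrM ?mulr_ge0 ?pi_ge0// invfM; ring.
rewrite rE -!mulrA.
set q := Num.sqrt (2 * pi) in q0 q3 *.
rewrite ler_wpM2l// ler_wpM2l ?(ltW theta_gt0)// ler_wpM2l ?invr_ge0 ?(ltW sk)//.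
rewrite -(ler_pM2l q0) [leRHS]mulrBr !mulVKf ?gt_eqF//.
have qe : q * (gamma / k%:R + theta / Num.sqrt k%:R) <= 3 * e.
  apply: le_trans (ler_wpM2l (ltW q0) err) _; rewrite ler_wpM2r//.
  by rewrite divr_ge0 ?addr_ge0 ?(ltW kR).
have e6 : 6 * e <= 1 / (300 * m%:R).
  rewrite ler_pdivlMr ?pmulr_rgt0 ?ltr0n//; lra.
have e0 : 0 <= e by rewrite divr_ge0 ?addr_ge0 ?(ltW kR).
move: (1 / _) e6 qe => z e6; move: (q * _) => w qe.
have : 3 * e <= E * z by nra.
lra.
Qed.

(** Here the Euclidean norm of [D] enters: the exponents add up to at most [1/2], so the
    exponentials multiply to at least [1/2]. The relative errors cost [1 - 1/300] by Bernoulli. *)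
Lemma prod_gauss_lower (D : 'I_m -> R) : \sum_i D i ^+ 2 <= k%:R ->
  49 / 100 * r ^+ m <=
  \prod_i (r * (expR (- (D i ^+ 2 / (2 * k%:R))) * (1 - 1 / (300 * m%:R)))).
Proof.
move=> Dk.
have kR := k_gt0R; have m0 : 0 < m%:R :> R by rewrite ltr0n.
have r0 : 0 <= r by rewrite divr_ge0 ?sqrtr_ge0// mulr_ge0// ltW.
move: r r0 => q q0.
rewrite !big_split/= !prodr_const card_ord -expR_sum mulrC ler_wpM2l ?exprn_ge0//.
rewrite sumrN -mulr_suml.
have E_ge : 1 / 2 <= expR (- ((\sum_i D i ^+ 2) / (2 * k%:R))).
  apply: le_trans (expR_ge1Dx _).
  have : (\sum_i D i ^+ 2) / (2 * k%:R) <= 1 / 2 by rewrite ler_pdivrMr ?mulr_gt0//; lra.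
  lra.
have m1 : 1 <= m%:R :> R by rewrite ler1n.
have m300 : 0 < 300 * m%:R :> R by rewrite pmulr_rgt0 ?ltr0n.
have B : 1 - m%:R * (1 / (300 * m%:R)) <= (1 - 1 / (300 * m%:R)) ^+ m :> R.
  apply: bernoulli_ineq; apply/andP; split; first by rewrite divr_ge0// ltW.
  rewrite ler_pdivrMr//; lra.
have e : m%:R * (1 / (300 * m%:R)) = 1 / 300 :> R 
  by rewrite !mul1r invfM mulrC -mulrA mulVf ?gt_eqF// mulr1.
rewrite e in B.
by move: (expR _) (_ ^+ m) E_ge B => x y; nra.
Qed.

End middle_range.

(** * The random subset sums *)

Section coordinates_laws.
Context {d : measure_display} {T : measurableType d} {R : realType}.
Variable P : probability T R.
Variables (N m : nat) (Y : 'I_N -> {RV P >-> m.-tuple R}).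
Hypothesis indY : mutually_independent Y.
Hypothesis lawY : forall j j', same_law (Y j) (Y j').

Lemma near_normal_set_sum (gamma : R) (k0 : nat) (i : 'I_m) (j0 : 'I_N) (S : {set 'I_N}) :
  gaussian_convergent (coord Y i j0) gamma k0 -> (k0 <= #|S|)%N ->
  near_normal (normalized_set_sum (coord Y i) S) (gamma / #|S|%:R).
Proof.
move=> [_ conv] k0S; apply: conv => //.
  apply: (mutually_independent_inj (X := coord Y i) (h := fun l : 'I_#|S| => enum_val l)).
    exact: enum_val_inj.
  exact: coord_indep.
by move=> l; exact: coord_law.
Qed.

Lemma coord_window_le (M theta y : R) (i : 'I_m) (j0 j : 'I_N) : 0 < theta ->
  max_density_le (coord Y i j0) M ->
  (P [set t | (`|coord Y i j t - y| <= theta)%R] <= (2 * theta * M)%:E)%E.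
Proof.
move=> t0 [f Xf fM].
have mW : measurable [set x : R | `|x - y| <= theta].
  rewrite -[X in measurable X]setTI.
  apply: (measurable_fun_le (f := fun x : R => `|x - y|) (g := fun=> theta)) => //.
  by apply: measurableT_comp => //; exact: measurable_funB.
have -> : P [set t | `|coord Y i j t - y| <= theta] = P [set t | `|1 * coord Y i j0 t - y| <= theta].
  under [in RHS]eq_set do rewrite mul1r.
  exact: (coord_law i (lawY j j0) mW).
have := density_window_le (y := y) (b := M) Xf ltr01 t0; rewrite !divr1; apply.
by move=> x _; exact: fM.
Qed.

End coordinates_laws.

Lemma prode_le {R : realType} (I : finType) (F : I -> \bar R) (g : I -> R) :
  (forall i, 0 <= F i)%E -> (forall i, (F i <= (g i)%:E)%E) ->
  (\prod_i F i <= (\prod_i g i)%:E)%E.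
Proof.
move=> F0 Fg.
have : (0 <= \prod_i F i <= (\prod_i g i)%:E)%E.
  elim/big_rec2 : _ => [|i x y _ /andP[x0 xy]]; first by rewrite lee01 lexx.
  by rewrite mule_ge0//= EFinM lee_pmul.
by case/andP.
Qed.

Lemma prode_ge {R : realType} (I : finType) (F : I -> \bar R) (g : I -> R) :
  (forall i, 0 <= g i) -> (forall i, ((g i)%:E <= F i)%E) ->
  ((\prod_i g i)%:E <= \prod_i F i)%E.
Proof.
move=> g0 Fg.
have : (0 <= \prod_i g i) && ((\prod_i g i)%:E <= \prod_i F i)%E.
  elim/big_rec2 : _ => [|i x y _ /andP[x0 xy]]; first by rewrite ler01 lexx.
  by rewrite mulr_ge0//= EFinM lee_pmul// lee_fin.
by case/andP.
Qed.

Lemma overlap_bounds (k a k0 s : nat) : (2 <= a)%N -> (2 * a * k0 <= k)%N ->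
  (k <= 2 * a * s)%N -> (2 * a * s <= 3 * k)%N -> (s <= k)%N ->
  [/\ (k0 <= s)%N, (k0 <= k - s)%N & (k <= 4 * (k - s))%N].
Proof.
move=> a2 ak0 lo hi sk.
have a0 : (0 < 2 * a)%N by rewrite muln_gt0 (leq_trans _ a2).
have ks : (k0 <= s)%N by rewrite -(leq_pmul2l a0) (leq_trans ak0).
have h1 : (4 * k0 <= 2 * a * k0)%N by rewrite leq_mul2r; lia.
have h2 : (4 * s <= 2 * a * s)%N by rewrite leq_mul2r; lia.
by split => //; lia.
Qed.

Lemma subr1_inv300_ge0 (R : realType) (m : nat) : (0 < m)%N ->
  0 <= 1 - 1 / (300 * m%:R) :> R.
Proof.
move=> m0; have m1 : 1 <= m%:R :> R by rewrite ler1n.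
have m300 : 0 < 300 * m%:R :> R by rewrite pmulr_rgt0 ?ltr0n.
by rewrite subr_ge0 ler_pdivrMr // mul1r; lra.
Qed.

(** * First and second moments of the count *)

Section assembly.
Variables (R : realType) (k m a : nat) (theta : R)
  (d : measure_display) (T : measurableType d) (P : probability T R)
  (Y : 'I_(a * k) -> {RV P >-> m.-tuple R}) (k0 : nat) (gamma M : R) (D : 'I_m -> R).
Local Notation u := (Num.sqrt (Num.sqrt m%:R) : R).
Local Notation C := ('C(a * k, k)%:R : R).
Local Notation r := (2 * theta / Num.sqrt (2 * pi * k%:R)).
Hypotheses (k_gt0 : (0 < k)%N) (m_gt0 : (0 < m)%N).
Hypothesis aE : a%:Z = Num.ceil (2 * Num.sqrt (m%:R : R)).
Hypothesis theta_gt0 : 0 < theta.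
Hypothesis rC : r ^+ m * C = 1.
Hypothesis indY : mutually_independent Y.
Hypothesis lawY : forall j j', same_law (Y j) (Y j').
Hypothesis indC : forall j, mutually_independent (fun i => coordinate (Y j) i : {RV P >-> R}).
Hypotheses (k0_gt0 : (0 < k0)%N) (gamma_ge0 : 0 <= gamma) (M_gt0 : 0 < M).
Variable j0 : 'I_(a * k).
Hypothesis convY : forall i, gaussian_convergent (coord Y i j0) gamma k0.
Hypothesis maxY : forall i, max_density_le (coord Y i j0) M.
Hypothesis k_ge_k0 : (4 * Num.sqrt m%:R + 2) * k0%:R <= k%:R :> R.
Hypothesis k_ge_M : 144 * m%:R `^ (3 / 2) * (ln M + 3) <= k%:R.
Hypothesis k_ge_gamma : 150 * 10 ^+ 3 * (gamma + 1) * m%:R `^ (7 / 4) <= k%:R.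
Hypothesis D_le : \sum_i D i ^+ 2 <= k%:R.
Implicit Types K : {set 'I_(a * k)}.

Let kR : 0 < k%:R :> R. Proof. by rewrite ltr0n. Qed.
Let u1 : 1 <= u. Proof. exact: root4_ge1. Qed.
Let u4 : u ^+ 4 = m%:R. Proof. exact: exp4_root4. Qed.
Let a2 : (2 <= a)%N. Proof. exact: (a_ge2 m_gt0 aE). Qed.
Let age : 2 * u ^+ 2 <= a%:R. Proof. exact: (a_ge aE). Qed.
Let ale : a%:R <= 3 * u ^+ 2. Proof. exact: (a_le m_gt0 aE). Qed.
Let tsq : theta * Num.sqrt k%:R <= 1.
Proof. exact: (theta_sqrt_le k_gt0 m_gt0 aE theta_gt0 rC gamma_ge0 k_ge_gamma). Qed.
Let gk : (gamma + 1) / k%:R * u ^+ 7 <= 1 / 2000.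
Proof. exact: (gamma1_div_k_le k_gt0 gamma_ge0 k_ge_gamma). Qed.
Let ak0 : (2 * a * k0 <= k)%N. Proof. exact: (two_a_k0_le aE k_ge_k0). Qed.
Let r0 : 0 < r. Proof. exact: (r_gt0 k_gt0 theta_gt0). Qed.

Lemma event_prob_lower K : #|K| = k ->
  ((49 / 100 * r ^+ m)%:E <= P (event Y K D theta))%E.
Proof.
move=> cK; rewrite prob_event//.
apply: le_trans (prode_ge (g := fun i => r * (expR (- (D i ^+ 2 / (2 * k%:R))) *
   (1 - 1 / (300 * m%:R)))) _ _).
- by rewrite lee_fin; exact: prod_gauss_lower.
- move=> i; apply: mulr_ge0; first exact: ltW r0.
  by apply: mulr_ge0; [exact: expR_ge0|exact: subr1_inv300_ge0].
move=> i.
have Kk : (k0 <= #|K|)%N.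
  by rewrite cK; apply: leq_trans ak0; rewrite leq_pmull// muln_gt0/= (leq_trans _ a2).
have K0 : (0 < #|K|)%N by rewrite cK.
have nK := near_normal_set_sum indY lawY (convY i) Kk.
have sk : 0 < Num.sqrt #|K|%:R :> R by rewrite sqrtr_gt0 ltr0n.
have := near_normal_window_ge (D i) nK sk theta_gt0.
have -> : [set t | `|Num.sqrt #|K|%:R * normalized_set_sum (coord Y i) K t - D i| <= theta] =
  window (coord Y i) K (D i) theta.
  by apply/seteqP; split => t; rewrite /window /= set_sumE.
apply: le_trans; rewrite cK lee_fin.
apply: (gauss_window_lower (u := u)) => //.
apply: le_trans D_le; rewrite (bigD1 i)//= lerDl sumr_ge0// => j _.
exact: sqr_ge0.
Qed.

(** The 4 is a crude bound for [e >= (1 + 1 / m)^m]. *)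
Lemma event_pair_middle K K' : #|K| = k -> #|K'| = k ->
  (k <= 2 * a * #|K :&: K'|)%N -> (2 * a * #|K :&: K'| <= 3 * k)%N ->
  (P (event Y K D theta `&` event Y K' D theta) <= (4 * (r ^+ m) ^+ 2)%:E)%E.
Proof.
move=> cK cK' lo hi; rewrite prob_eventI//.
set s := #|_| in lo hi.
have sk : (s <= k)%N by rewrite -cK subset_leq_card// finset.subsetIl.
pose n := (k - s)%N.
have snk : (s + n)%N = k by rewrite subnKC.
have cs1 : #|(K :\: K')%SET| = n by rewrite cardsD cK.
have cs2 : #|(K' :\: K)%SET| = n by rewrite cardsD cK' finset.setIC.
have [s_k0 n_k0 k4n] := overlap_bounds a2 ak0 lo hi sk.
rewrite -/n in n_k0 k4n.
have s0 : (0 < s)%N by exact: leq_trans s_k0.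
have n0 : (0 < n)%N by exact: leq_trans n_k0.
have mid := middle_le k_gt0 m_gt0 u1 u4 a2 age ale theta_gt0 gamma_ge0 tsq gk snk lo hi.
apply: le_trans (prode_le (g := fun=> r ^+ 2 * (1 + 1 / m%:R)) _ _) _.
- by move=> i; exact: measure_ge0.
- move=> i.
  have nb0 : (0 : R) < n%:R by rewrite ltr0n.
  have e1 : gamma / n%:R + theta / Num.sqrt n%:R <= 1.
    apply: le_trans (window_error_le gamma theta_gt0 tsq n0 _) _; first by rewrite /n leq_subr.
    have kn : k%:R <= 4 * n%:R :> R by rewrite -[4]/(4%:R) -natrM ler_nat.
    have e8 : (gamma + 1) / k%:R <= 1 / 2000.
      apply: le_trans gk; rewrite ler_peMr ?exprn_ege1// divr_ge0 ?addr_ge0//.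
    rewrite ler_pdivrMr// mul1r; move: e8; rewrite ler_pdivrMr// => e8; lra.
  apply: le_trans (overlapping_window_le (bs := gamma / s%:R) (bn := gamma / n%:R)
    (coord_indep i indY) (D i) (erefl s) cs1 cs2 s0 n0 _ _ _ _ _ theta_gt0 e1) _.
  + exact: near_normal_set_sum.
  + by rewrite -cs1; apply: near_normal_set_sum; rewrite ?cs1.
  + by rewrite -cs2; apply: near_normal_set_sum; rewrite ?cs2.
  + by rewrite divr_ge0.
  + by rewrite divr_ge0.
  by rewrite lee_fin.
rewrite lee_fin prodr_const card_ord exprMn mulrC -!exprM [(2 * m)%N]mulnC.
rewrite ler_wpM2r ?exprn_ge0 ?(ltW r0)//.
have m0 : 0 < m%:R :> R by rewrite ltr0n.
apply: (@le_trans _ _ (expR (1 / m%:R) ^+ m)).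
  rewrite lerXn2r ?nnegrE ?expR_ge0 ?expR_ge1Dx//.
rewrite -expRM_natl mulrCA mul1r mulfV ?gt_eqF//.
have h : 1 / 2 <= expR (- (1 / 2)) :> R by apply: le_trans (expR_ge1Dx _); lra.
have e : expR 1 * (expR (- (1 / 2)) * expR (- (1 / 2))) = 1 :> R.
  by rewrite -!expRD -[RHS]expR0; congr expR; lra.
move: (expR 1) (expR (- (1 / 2))) (expR_gt0 (1 : R)) e h => x y x0 e h.
have y2 : 1 / 4 <= y * y by nra.
have := ler_wpM2l (ltW x0) y2; lra.
Qed.

Lemma event_pair_distinct K K' : #|K| = k -> #|K'| = k -> K != K' ->
  (P (event Y K D theta `&` event Y K' D theta) <=
   P (event Y K D theta) * ((2 * theta * M) ^+ m)%:E)%E.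
Proof.
move=> cK cK' KK'.
(* Equal cardinalities exclude a strict inclusion of [K'] in [K]. *)
have [j jK' jK] : exists2 j, j \in K' & j \notin K.
  apply/subsetPn; apply: contra_neqN KK' => sub; apply/esym/eqP.
  by rewrite eqEcard sub cK cK' leqnn.
rewrite prob_eventI// prob_event//.
have tM : 0 <= 2 * theta * M by rewrite !mulr_ge0// ltW.
have -> : ((2 * theta * M) ^+ m)%:E = (\prod_(i < m) (2 * theta * M)%:E)%E :> \bar R.
  by rewrite prodEFin prodr_const card_ord.
rewrite -big_split/=.
have : (0 <= \prod_(i < m) P (window (coord Y i) K (D i) theta `&` window (coord Y i) K' (D i) theta) <=
   \prod_(i < m) (P (window (coord Y i) K (D i) theta) * (2 * theta * M)%:E))%E.
  elim/big_rec2 : _ => [|i x y _ /andP[x0 xy]]; first by rewrite lee01 lexx.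
  rewrite mule_ge0//= lee_pmul//.
  apply: (distinct_window_le (coord_indep i indY) _ jK' jK) => // y'.
  exact: (coord_window_le lawY _ _ theta_gt0 (maxY i)).
by case/andP.
Qed.

Let E K := event Y K D theta.
Let p K := fine (P (E K)).
Let pp K K' := fine (P (E K `&` E K')).
Let q := (2 * theta * M) ^+ m.

Lemma measurable_event K : measurable (E K).
Proof.
apply: bigsetI_measurable => i _.
exact: cylinders_sigma_measurable (cylinders_window _ _ (fintype.subxx K)).
Qed.

Let PE K : P (E K) = (p K)%:E.
Proof. by rewrite fineK// fin_num_measure//; exact: measurable_event. Qed.

Let PEE K K' : P (E K `&` E K') = (pp K K')%:E.
Proof.
by rewrite fineK// fin_num_measure//; apply: measurableI; exact: measurable_event.
Qed.

Let p_ge0 K : 0 <= p K. Proof. by rewrite fine_ge0. Qed.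

Let q_ge0 : 0 <= q.
Proof. by rewrite exprn_ge0// !mulr_ge0// ltW. Qed.

Let sum_card_const (x : R) : \sum_(K : {set 'I_(a * k)} | #|K| == k) x = C * x.
Proof.
have -> : 'C(a * k, k) = #|[set K : {set 'I_(a * k)} | #|K| == k]%SET|.
  by rewrite card_draws card_ord.
rewrite mulr_natl sumr_const; congr (_ *+ _).
by apply: eq_card => K; rewrite !inE.
Qed.

Lemma expected_count_ge : 49 / 100 <= \sum_(K : {set 'I_(a * k)} | #|K| == k) p K.
Proof.
rewrite [leLHS](_ : _ = C * (49 / 100 * r ^+ m)); last first.
  by rewrite mulrCA [C * _]mulrC rC mulr1.
rewrite -sum_card_const.
apply: ler_sum => K /eqP cK; rewrite -lee_fin -PE.
exact: event_prob_lower.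
Qed.

(** One [p K] is the diagonal term and the other covers both tails by [tail_le]. The middle pairs
    number at most [C], and [C (r^m)^2 = r^m]. *)
Lemma pair_sum_le K : #|K| = k ->
  \sum_(K' : {set 'I_(a * k)} | #|K'| == k) pp K K' <= 2 * p K + 4 * r ^+ m.
Proof.
move=> cK.
pose up := [pred K' : {set 'I_(a * k)} | (3 * k < 2 * a * #|K :&: K'|)%N].
pose lo := [pred K' : {set 'I_(a * k)} | (2 * a * #|K :&: K'| < k)%N].
have rm0 : 0 <= (r ^+ m) ^+ 2 by rewrite sqr_ge0.
(* Diagonal, middle and tail bounds are simply added: all are nonnegative, so each [K'] needs only
   one of them. *)
apply: (@le_trans _ _ (\sum_(K' : {set 'I_(a * k)} | #|K'| == k) ((K' == K)%:R * p K +
    (4 * (r ^+ m) ^+ 2 + ((up K')%:R + (lo K')%:R) * (p K * q))))).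
  apply: ler_sum => K' /eqP cK'.
  have pq : 0 <= p K * q by rewrite mulr_ge0 ?p_ge0.
  have r4 : 0 <= 4 * (r ^+ m) ^+ 2 := mulr_ge0 (ler0n _ _) rm0.
  have upq (n n' : nat) : 0 <= (n%:R + n'%:R) * (p K * q).
    by rewrite -natrD mulr_ge0.
  have [->|KK'] := eqVneq K' K.
    rewrite mul1r -lee_fin -PEE /E setIid PE lee_fin lerDl.
    exact: addr_ge0.
  rewrite mul0r add0r.
  have dist : pp K K' <= p K * q.
    by rewrite -lee_fin -PEE EFinM -PE; apply: event_pair_distinct => //; rewrite eq_sym.
  case upE : (up K').
    apply: (le_trans dist).
    have : 0 <= (lo K')%:R * (p K * q) by rewrite mulr_ge0.
    rewrite -[true%:R]/(1 : R).
    by move: (p K * q) (4 * _) ((lo K')%:R : R) r4 => x y z; lra.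
  case loE : (lo K'); first by rewrite add0r mul1r (le_trans dist)// lerDr.
  rewrite addr0 mul0r addr0 -lee_fin -PEE; apply: event_pair_middle => //.
    by rewrite leqNgt; apply/negbT.
  by rewrite leqNgt; apply/negbT.
rewrite !big_split/= sum_card_const -[X in X + _]mulr_suml -[X in _ + (_ + X)]mulr_suml big_split/=.
have cI : #|'I_(a * k)| = (a * k)%N by rewrite card_ord.
have a0 : (0 < a)%N by exact: leq_trans a2.
have cnt (Q : pred {set 'I_(a * k)}) : \sum_(K' : {set 'I_(a * k)} | #|K'| == k) (Q K')%:R =
    #|[set K' : {set 'I_(a * k)} | (#|K'| == k) && Q K']%SET|%:R :> R.
  rewrite -sum1dep_card natr_sum big_mkcondr/=; apply: eq_bigr => K' _.
  by case: (Q K').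
have -> : \sum_(K' : {set 'I_(a * k)} | #|K'| == k) (K' == K)%:R = 1 :> R.
  rewrite (bigD1 K) ?cK//= eqxx big1 ?addr0// => K' /andP[_ /negbTE ->]; by [].
rewrite !cnt.
have tu := card_intersection_upper_tail R a0 k_gt0 cI cK.
have tl := card_intersection_lower_tail R a0 k_gt0 cI cK.
have tt := tail_le k_gt0 m_gt0 aE rC gamma_ge0 M_gt0 k_ge_M k_ge_gamma.
rewrite -/q in tt.
set nu := (X in (X + _) * (p K * q)); set nl := (X in (_ + X) * (p K * q)).
have tnu : nu <= C * expR (- (k%:R / (16 * a%:R))) by exact: tu.
have tnl : nl <= C * expR (- (k%:R / (16 * a%:R))) by exact: tl.
have nq : (nu + nl) * q <= 1.
  by apply: le_trans tt; rewrite ler_wpM2r// mulr_natl mulr2n lerD.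
have npq : (nu + nl) * (p K * q) <= p K.
  by rewrite mulrCA ler_piMr ?p_ge0.
have -> : C * (4 * (r ^+ m) ^+ 2) = 4 * r ^+ m.
  rewrite [LHS](_ : _ = 4 * (r ^+ m) * (r ^+ m * C)); last by ring.
  by rewrite rC mulr1.
by move: npq; move: (_ * (p K * q)) (4 * r ^+ m) => x y; lra.
Qed.

Lemma prob_bigcup_event_ge :
  ((25^-1)%:E <= P (\big[setU/set0]_(K <- enum [pred K : {set 'I_(a * k)} | #|K| == k]) E K))%E.
Proof.
set s := enum _.
pose mu := \sum_(K : {set 'I_(a * k)} | #|K| == k) p K.
have mu_ge : 49 / 100 <= mu := expected_count_ge.
(* The maximizer of [2 c mu - c^2 (2 mu + 4)], with value [mu^2 / (2 mu + 4)]; this is at least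
   [1/25] once [mu >= 49/100]. *)
pose c := mu / (2 * mu + 4).
have den : 0 < 2 * mu + 4 by lra.
have c0 : 0 <= c by rewrite divr_ge0//; lra.
have sumS (F : {set 'I_(a * k)} -> R) : \sum_(K <- s) F K = \sum_(K : {set 'I_(a * k)} | #|K| == k) F K.
  by rewrite /s big_enum.
have S_le : \sum_(K <- s) \sum_(K' <- s) pp K K' <= 2 * mu + 4.
  rewrite sumS; apply: (@le_trans _ _ (\sum_(K : {set 'I_(a * k)} | #|K| == k) (2 * p K + 4 * r ^+ m))).
    by apply: ler_sum => K /eqP cK; rewrite sumS; exact: pair_sum_le.
  rewrite big_split/= -mulr_sumr sum_card_const mulrCA [C * _]mulrC rC mulr1.
  by rewrite lexx.
have := second_moment P s measurable_event c0.
rewrite (eq_bigr (fun K => (p K)%:E)); last by move=> K _; exact: PE.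
rewrite sumEFin sumS -/mu.
rewrite [X in (_ <= _ + _ * X)%E -> _](_ : _ = (\sum_(K <- s) \sum_(K' <- s) pp K K')%:E); last first.
  rewrite -sumEFin; apply: eq_bigr => K _; rewrite -sumEFin.
  by apply: eq_bigr => K' _; exact: PEE.
have mU : measurable (\big[setU/set0]_(K <- s) E K).
  by apply: bigsetU_measurable => K _; exact: measurable_event.
rewrite -[P (\big[setU/set0]_(K <- s) E K)]fineK; last by rewrite fin_num_measure.
rewrite -!EFinM -EFinD !lee_fin.
move: (fine _) => x h.
have : 2 * c * mu - c ^+ 2 * (2 * mu + 4) <= x.
  have := ler_wpM2l (sqr_ge0 c) S_le; lra.
apply: le_trans.
have -> : 2 * c * mu - c ^+ 2 * (2 * mu + 4) = mu ^+ 2 / (2 * mu + 4).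
  by rewrite /c; field; rewrite gt_eqF.
rewrite ler_pdivlMr//; nra.
Qed.

End assembly.

Lemma row_norm_leP {R : realType} (m : nat) (v : 'rV[R]_m) (x : R) : 0 <= x ->
  (`|v| <= x) <-> forall i, `|v ord0 i| <= x.
Proof.
move=> x0; rewrite [`|v|]mx_normrE; split=> [/bigmax_leP[_ vx] i|vx].
  exact: (vx (ord0, i)).
by apply/bigmax_leP; split => // -[i j] _ /=; rewrite ord1.
Qed.

Lemma event_normE {d : measure_display} {T : measurableType d} {R : realType}
    (P : probability T R) (N m : nat) (Y : 'I_N -> {RV P >-> m.-tuple R})
    (D : 'rV[R]_m) (theta : R) (K : {set 'I_N}) (t : T) : 0 <= theta ->
  event Y K (D ord0) theta t <->
  `|(\sum_(j in K) row_of_tuple (Y j t)) - D| <= theta.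
Proof.
move=> theta0; rewrite row_norm_leP//.
have entry i : ((\sum_(j in K) row_of_tuple (Y j t)) - D) ord0 i =
    set_sum (coord Y i) K t - D ord0 i.
  by rewrite !mxE summxE; congr (_ - _); apply: eq_bigr => j _; rewrite mxE.
split=> [Et i|h].
  rewrite entry; move: Et; rewrite /event (bigD1 i)//= => -[+ _]; exact.
rewrite /event; elim/big_ind : _ => // i _.
by rewrite /window /= -entry.
Qed.

Theorem lemma1 (R : realType) (k m a : nat) (theta : R)
  (d : measure_display) (T : measurableType d) (P : probability T R)
  (Y : 'I_(a * k) -> {RV P >-> m.-tuple R})
  (k0 : nat) (gamma M : R) :
  (0 < k)%N -> (0 < m)%N ->
  a%:Z = Num.ceil (2 * Num.sqrt (m%:R : R)) ->
  0 < theta ->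
  (2 * theta / Num.sqrt (2 * pi * k%:R)) ^+ m * ('C(a * k, k))%:R = 1 ->
  mutually_independent Y ->
  (forall j j' : 'I_(a * k), same_law (Y j) (Y j')) ->
  (forall j : 'I_(a * k),
     mutually_independent (fun i : 'I_m => coordinate (Y j) i : {RV P >-> R})) ->
  (0 < k0)%N -> 0 <= gamma -> 0 < M ->
  (forall (j : 'I_(a * k)) (i : 'I_m), j = 0%N :> nat ->
     gaussian_convergent (coordinate (Y j) i : {RV P >-> R}) gamma k0 /\
     max_density_le (coordinate (Y j) i : {RV P >-> R}) M) ->
  Num.max ((4 * Num.sqrt m%:R + 2) * k0%:R)
    (Num.max (144 * m%:R `^ (3 / 2) * (ln M + 3))
             (150 * 10 ^+ 3 * (gamma + 1) * m%:R `^ (7 / 4))) <= k%:R ->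
  forall D : 'rV[R]_m, l2norm D <= Num.sqrt k%:R ->
  ((25^-1)%:E <=
   P [set t | exists K : {set 'I_(a * k)},
        #|K| = k /\
        (`|(\sum_(j in K) row_of_tuple (Y j t)) - D| <= theta)%R])%E.
Proof.
move=> k_gt0 m_gt0 aE theta_gt0 rC indY lawY indC k0_gt0 gamma_ge0 M_gt0 convY.
rewrite !ge_max => /and3P[k_ge_k0 k_ge_M k_ge_gamma] D D_le.
have ak_gt0 : (0 < a * k)%N.
  by rewrite muln_gt0 k_gt0 andbT (leq_trans _ (a_ge2 m_gt0 aE)).
pose j0 := Ordinal ak_gt0.
have D2_le : \sum_i D ord0 i ^+ 2 <= k%:R.
  rewrite -(@ler_sqrt _ _ k%:R) ?ler0n//.
have conv0 i := (convY j0 i erefl).1; have max0 i := (convY j0 i erefl).2.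
have := prob_bigcup_event_ge k_gt0 m_gt0 aE theta_gt0 rC indY lawY indC k0_gt0
  gamma_ge0 M_gt0 conv0 max0 k_ge_k0 k_ge_M k_ge_gamma D2_le.
set U := \big[setU/set0]_(K <- _) _.
(* The set of the statement equals this finite union of events, which also makes it measurable. *)
suff -> : U = [set t | exists K : {set 'I_(a * k)}, #|K| = k /\
    `|(\sum_(j in K) row_of_tuple (Y j t)) - D| <= theta] by [].
rewrite /U -bigcup_seq; apply/seteqP; split=> [t [K /=]|t [K [cK Kt]]].
  rewrite mem_enum => /eqP cK Et; exists K; split => //.
  by apply/event_normE => //; exact: ltW.
exists K => /=; first by rewrite mem_enum inE; apply/eqP.
by apply/event_normE => //; exact: ltW.
Qed.
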